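(* Let $K$ be a field of characteristic $p>0$, and let $0\to N\to M\to L\to0$ be a short exact sequence of finitely presented $\mathcal D(P_n)$-modules. Then: 1. There exist finite dimensional filtrations $\{N_i\}$, $\{M_i\}$ and $\{L_i\}$ on the modules $N$, $M$ and $L$ respectively such that the last two are filtrations of standard type, the first one is strongly equivalent to a filtration of standard type on $N$, and $\dim_K(M_i)=\dim_K(N_i)+\dim_K(L_i)$ for all $i\ge0$. 2. $\mathrm{Dim}(M)=\max\{\mathrm{Dim}(N),\mathrm{Dim}(L)\}$. 3. Precisely one of the following statements is true: (a) $\mathrm{Dim}(N)<\mathrm{Dim}(M)=\mathrm{Dim}(L)$ and $e(M)=e(L)$; (b) $\mathrm{Dim}(L)<\mathrm{Dim}(M)=\mathrm{Dim}(N)$ and $e(M)=e(N)$; (c) $\mathrm{Dim}(N)=\mathrm{Dim}(M)=\mathrm{Dim}(L)$ and $e(M)=e(N)+e(L)$.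
   Context: $P_n=K[x_1,\dots,x_n]$, $n\ge1$; $\mathcal D(P_n)$ is the ring of $K$-linear differential operators on $P_n$. For $k\ge0$ let $\partial_i^{[k]}=\frac{\partial_i^k}{k!}$ be the operator $x^\alpha\mapsto\binom{\alpha_i}{k}x^{\alpha-ke_i}$ (zero if $k>\alpha_i$), $\partial^{[\beta]}=\prod_i\partial_i^{[\beta_i]}$. Then $\mathcal D(P_n)=\bigoplus_{\alpha,\beta\in\mathbb N^n}Kx^\alpha\partial^{[\beta]}$. Canonical filtration: $F=\{F_i\}$, $F_i=\bigoplus_{|\alpha|+|\beta|\le i}Kx^\alpha\partial^{[\beta]}$. Modules are left modules. Two filtrations $\{X_i\}$, $\{Y_i\}$ (on an algebra or module) are equivalent if there are natural numbers $a,c>0$, $b,d\geq 0$ with $X_i\subseteq Y_{ai+b}$ and $Y_i\subseteq X_{ci+d}$ for $i\gg0$; strongly equivalent if one can take $a=c=1$. A filtration of standard type on $\mathcal D(P_n)$ is a finite dimensional filtration $\{F_i'\}$ equivalent to $F$; a filtration of standard type on a finitely generated module $M=\mathcal D(P_n)M_0$ ($\dim_KM_0<\infty$) is one of the form $\{F_i'M_0\}$. For $f:\mathbb N\to\mathbb N$, $\gamma(f):=\inf\{r\ge0: f(i)\le i^r\text{ for }i\gg0\}$. $D=\mathrm{Dim}(M):=\gamma(i\mapsto\dim_KF_iM_0)$, and for finitely presented $M$ the multiplicity $e(M)$ is defined, using the canonical filtration, by $\dim_K(F_iM_0)=\frac{e(M)}{D!}i^D+o(i^D)$ (the limit exists);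 both are independent of $M_0$. (For the zero module both are $0$.) *)

(* Defs.v *)
From HB Require Import structures.
From mathcomp Require Import all_boot all_order all_algebra.
From mathcomp Require Import boolp classical_sets functions.
From mathcomp Require mpoly.
Set Implicit Arguments.
Unset Strict Implicit.
Unset Printing Implicit Defensive.
Import Order.TTheory GRing.Theory Num.Theory.
Local Open Scope ring_scope.

(* Grothendieck's ring of K-linear differential operators on a commutative
   K-algebra A: the operators of order <= 0 are the A-linear ones, and f has
   order <= k.+1 iff every commutator [f, r] = f \o r - r \o f, r in A, has
   order <= k. The product is composition. *)
Section DiffOp.
Variables (K : fieldType) (A : comAlgType K).
Implicit Types (f g : A -> A) (r : A) (k : nat).

Definition comm_mul f r : A -> A := fun x => f (r * x) - r * f x.

Fixpoint diff_order k f : Prop :=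
  match k with
  | 0 => forall r, comm_mul f r = (fun=> 0)
  | k'.+1 => forall r, diff_order k' (comm_mul f r)
  end.

Definition is_diffop f : Prop :=
  linear f /\ exists k, diff_order k f.

Definition diffop_pred : {pred A -> A} := [pred f | `[< is_diffop f >]].

Record diffop := DiffOp { dop : A -> A; dopP : dop \in diffop_pred }.

HB.instance Definition _ := [isSub for dop].
HB.instance Definition _ := [Choice of diffop by <:].

Lemma linD f : linear f -> {morph f : x y / x + y}.
Proof. by move=> fl x y; have := fl 1 x y; rewrite !scale1r. Qed.
Lemma lin0 f : linear f -> f 0 = 0.
Proof. by move=> fl; apply: (addIr (f 0)); rewrite -linD // !add0r. Qed.
Lemma linZ f : linear f -> forall c, {morph f : x / c *: x}.
Proof. by move=> fl c x; have := fl c x 0; rewrite !addr0 lin0 // addr0. Qed.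
Lemma linN f : linear f -> {morph f : x / - x}.
Proof.
move=> fl x; apply/eqP; rewrite -addr_eq0 -linD // addNr; exact/eqP/lin0.
Qed.

Lemma diff_order0 k : diff_order k (fun=> 0).
Proof.
by elim: k => [|k IH] r; rewrite (_ : comm_mul _ _ = fun=> 0) //;
  apply/funext => x; rewrite /comm_mul mulr0 subrr.
Qed.

Lemma diff_orderS k f : diff_order k f -> diff_order k.+1 f.
Proof.
elim: k f => [|k IH] f fk r; last exact: IH (fk r).
rewrite fk; exact: (@diff_order0 0).
Qed.

Lemma diff_orderW k l f : (k <= l)%N -> diff_order k f -> diff_order l f.
Proof.
move=> /subnK <-; elim: (l - k)%N => [//|m IH] fk.
by rewrite addSn; apply/diff_orderS/IH.
Qed.

Lemma diff_orderB k f g :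
  diff_order k f -> diff_order k g -> diff_order k (fun x => f x - g x).
Proof.
have cB r f' g' : comm_mul (fun x => f' x - g' x) r =
    (fun x => comm_mul f' r x - comm_mul g' r x).
  by apply/funext => x; rewrite /comm_mul mulrBr opprD addrACA -opprD.
elim: k f g => [|k IH] f g fk gk r; rewrite cB; last exact: IH.
by rewrite fk gk; apply/funext => x; rewrite subrr.
Qed.

Lemma diff_orderD k f g :
  diff_order k f -> diff_order k g -> diff_order k (fun x => f x + g x).
Proof.
move=> fk gk; rewrite (_ : (fun _ => _) = fun x => f x - (0 - g x)).
  by apply: diff_orderB => //; apply: diff_orderB => //; exact: diff_order0.
by apply/funext => x; rewrite sub0r opprK.
Qed.

Lemma diff_orderM k l f g : linear f -> linear g ->
  diff_order k f -> diff_order l g -> diff_order (k + l) (f \o g).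
Proof.
have cl f' r : linear f' -> linear (comm_mul f' r).
  move=> fl c x y; rewrite /comm_mul.
  by rewrite mulrDr -scalerAr !fl mulrDr -scalerAr scalerBr opprD addrACA.
have cM r f' g' : linear f' -> comm_mul (f' \o g') r =
    (fun x => (comm_mul f' r \o g') x + (f' \o comm_mul g' r) x).
  move=> fl; apply/funext => x; rewrite /comm_mul /= (linD fl) (linN fl).
  by rewrite [RHS]addrC addrA subrK.
have [m] := ubnP (k + l)%N; elim: m k l f g => // m IH k l f g.
rewrite ltnS => klm fl gl fk gl'.
have z0 f' : linear f' -> f' \o (fun=> 0) = (fun=> 0 : A).
  by move=> f'l; apply/funext => x /=; exact: lin0.
case: k fk klm => [|k] fk klm.
  case: l gl' klm => [|l] gl' klm r; rewrite cM //.
    by rewrite fk gl' z0 //; apply/funext => x /=; rewrite addr0.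
  apply: diff_orderD; first by rewrite fk; exact: diff_order0.
  by apply: (IH 0 l) => //; exact: cl.
move=> r; rewrite cM //; apply: diff_orderD.
  by apply: IH => //; exact: cl.
case: l gl' klm => [|l] gl' klm.
  by rewrite gl' z0 //; exact: diff_order0.
rewrite addnS -addSn; apply: IH => //; last exact: cl.
by move: klm; rewrite addnS.
Qed.

Lemma diffop_zmod : zmod_closed diffop_pred.
Proof.
split.
  apply/asboolP; split; first by move=> c x y; rewrite /= scaler0 addr0.
  by exists 0%N; exact: diff_order0.
move=> f g /asboolP[fl [k fk]] /asboolP[gl [l gl']]; apply/asboolP; split.
  move=> c x y; rewrite -[LHS]/(f (c *: x + y) - g (c *: x + y)) fl gl.
  by rewrite opprD addrACA -scalerBr.
exists (maxn k l); apply: diff_orderB.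
  exact: diff_orderW (leq_maxl _ _) fk.
exact: diff_orderW (leq_maxr _ _) gl'.
Qed.
HB.instance Definition _ := GRing.isZmodClosed.Build _ diffop_pred diffop_zmod.
HB.instance Definition _ := [SubChoice_isSubZmodule of diffop by <:].

Lemma dop_linear (u : diffop) : linear (dop u).
Proof. by case: u => f /= /asboolP[]. Qed.
HB.instance Definition _ (u : diffop) :=
  GRing.isLinear.Build K A A _ (dop u) (dop_linear u).

Lemma dopD (u v : diffop) x : dop (u + v) x = dop u x + dop v x.
Proof. by []. Qed.

Lemma diffop_eq (u v : diffop) : dop u =1 dop v -> u = v.
Proof. by move=> uv; apply/val_inj/funext. Qed.

Fact mulop_subproof r : ( *%R r : A -> A) \in diffop_pred.
Proof.
apply/asboolP; split; first by move=> c x y; rewrite mulrDr -scalerAr.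
by exists 0%N => s; apply/funext => x; rewrite /comm_mul mulrCA subrr.
Qed.
Definition mulop r : diffop := DiffOp (mulop_subproof r).

Fact diffop_mul_subproof (u v : diffop) : dop u \o dop v \in diffop_pred.
Proof.
case: u v => f /asboolP[fl [k fk]] [g /asboolP[gl [l gl']]] /=.
apply/asboolP; split; first by move=> c x y /=; rewrite gl fl.
by exists (k + l)%N; apply: diff_orderM.
Qed.
Definition diffop_mul u v : diffop := DiffOp (diffop_mul_subproof u v).

Fact diffop_mulA : associative diffop_mul.
Proof. by move=> u v w; apply: diffop_eq. Qed.
Fact diffop_mul1l : left_id (mulop 1) diffop_mul.
Proof. by move=> u; apply: diffop_eq => x /=; rewrite mul1r. Qed.
Fact diffop_mul1r : right_id (mulop 1) diffop_mul.
Proof. by move=> u; apply: diffop_eq => x /=; rewrite mul1r. Qed.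
Fact diffop_mulDl : left_distributive diffop_mul +%R.
Proof. by move=> u v w; apply: diffop_eq. Qed.
Fact diffop_mulDr : right_distributive diffop_mul +%R.
Proof.
by move=> u v w; apply: diffop_eq => x; rewrite [LHS]linearD.
Qed.
Fact diffop_1neq0 : mulop 1 != 0.
Proof.
apply/eqP => /(congr1 (fun u => dop u 1)) /= /eqP.
by rewrite mulr1 [X in _ == X](_ : _ = 0) // oner_eq0.
Qed.
HB.instance Definition _ := GRing.Zmodule_isNzRing.Build diffop
  diffop_mulA diffop_mul1l diffop_mul1r diffop_mulDl diffop_mulDr diffop_1neq0.

Lemma dopM (u v : diffop) x : dop (u * v) x = dop u (dop v x).
Proof. by []. Qed.
Lemma dop1 x : dop 1 x = x.
Proof. exact: mul1r. Qed.

Definition diffop_scale (c : K) (u : diffop) : diffop := mulop c%:A * u.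

Lemma dop_scale c u x : dop (diffop_scale c u) x = c *: dop u x.
Proof. exact: mulr_algl. Qed.

Fact diffop_scaleA a b u :
  diffop_scale a (diffop_scale b u) = diffop_scale (a * b) u.
Proof. by apply: diffop_eq => x; rewrite !dop_scale scalerA. Qed.
Fact diffop_scale1 : left_id 1 diffop_scale.
Proof. by move=> u; apply: diffop_eq => x; rewrite dop_scale scale1r. Qed.
Fact diffop_scaleDr : right_distributive diffop_scale +%R.
Proof.
by move=> a u v; apply: diffop_eq => x; rewrite dopD !dop_scale dopD scalerDr.
Qed.
Fact diffop_scaleDl u : {morph diffop_scale^~ u : a b / a + b}.
Proof.
by move=> a b; apply: diffop_eq => x; rewrite dopD !dop_scale scalerDl.
Qed.
HB.instance Definition _ := GRing.Zmodule_isLmodule.Build K diffop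
  diffop_scaleA diffop_scale1 diffop_scaleDr diffop_scaleDl.

Fact diffop_scaleAl a (u v : diffop) : a *: (u * v) = (a *: u) * v.
Proof. by apply: diffop_eq => x; rewrite dopM !dop_scale. Qed.
HB.instance Definition _ := GRing.Lmodule_isLalgebra.Build K diffop
  diffop_scaleAl.
Fact diffop_scaleAr a (u v : diffop) : a *: (u * v) = u * (a *: v).
Proof.
by apply: diffop_eq => x; rewrite dopM !dop_scale linearZ.
Qed.
HB.instance Definition _ := GRing.Lalgebra_isAlgebra.Build K diffop
  diffop_scaleAr.

End DiffOp.

(* mpoly is only imported locally: its notations clash with those of analysis *)
Section DPn.
Import mpoly.
Variables (K : fieldType) (n : nat).

Definition polyalg : comAlgType K := {mpoly K[n]}.

(* 'X_[m] |-> 'C(m i, k) 'X_[m - k U_(i)]; the subtraction of exponents is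
   truncated only when the binomial vanishes *)
Definition hasse (i : 'I_n) (k : nat) (q : polyalg) : polyalg :=
  \sum_(m <- msupp q) (q@_m * 'C(m i, k)%:R) *: 'X_[m - U_(i) *+ k].

Lemma mcoeff_hasse i k (q : {mpoly K[n]}) m :
  (hasse i k q : {mpoly K[n]})@_m = q@_(m + U_(i) *+ k) * 'C(m i + k, k)%:R.
Proof.
rewrite /hasse raddf_sum /=; pose m1 := (m + U_(i) *+ k)%MM.
have m1i : m1 i = (m i + k)%N by rewrite mnmDE mulmnE mnm1E eqxx mul1n.
transitivity (\sum_(m' <- msupp q | m' == m1) q@_m1 * 'C(m i + k, k)%:R).
  rewrite [RHS]big_mkcond; apply: eq_bigr => m' _.
  rewrite mcoeffZ mcoeffX; case: (eqVneq m' m1) => [->|/eqP m'1].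
    by rewrite m1i addmK eqxx mulr1.
  case: (leqP k (m' i)) => [le_k|lt_k]; last by rewrite bin_small // mulr0 mul0r.
  case: eqP => [E|_]; rewrite ?mulr0 //; case: m'1.
  apply/mnmP => j; rewrite /m1 -E mnmDE mnmBE subnK // mulmnE mnm1E.
  by case: eqP => [<-|]; rewrite ?mul1n.
case: (boolP (m1 \in msupp q)) => qm1.
  by rewrite -big_filter filter_pred1_uniq ?msupp_uniq // big_seq1.
by rewrite (memN_msupp_eq0 qm1) mul0r big1 // => m' _; rewrite mul0r.
Qed.

Lemma hasse_linear i k : linear (hasse i k).
Proof.
move=> c p q; apply/mpolyP => m.
rewrite mcoeffD mcoeffZ !mcoeff_hasse.
by rewrite mcoeffD mcoeffZ mulrDl mulrA.
Qed.

Lemma hasseX i k (m : 'X_{1..n}) :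
  hasse i k 'X_[m] = 'C(m i, k)%:R *: 'X_[m - U_(i) *+ k].
Proof. by rewrite /hasse msuppX big_seq1 mcoeffX eqxx mul1r. Qed.

Lemma polyalg_ind (P : polyalg -> Prop) :
  (forall m, P ('X_[m] : {mpoly K[n]})) ->
  (forall c p, P p -> P (c *: p)) -> (forall p q, P p -> P q -> P (p + q)) ->
  forall p, P p.
Proof.
move=> PX PZ PD; elim/mpolyind => [|c m p _ _ Pp].
  by rewrite -(scale0r ('X_[0%MM] : {mpoly K[n]})); apply: PZ.
by apply: PD => //; apply: PZ.
Qed.

Lemma comm_hasse i k (j : 'I_n) :
  comm_mul (hasse i k) ('X_j : {mpoly K[n]}) =
  (if (i == j) && (0 < k)%N then hasse i k.-1 else fun=> 0).
Proof.
apply/funext; apply: polyalg_ind => [m|c p|p q].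
- rewrite /comm_mul -mpolyXD !hasseX -scalerAr -mpolyXD.
  case: (eqVneq i j) => [<-|ij] /=; last first.
    rewrite mnmDE mnm1E eq_sym (negbTE ij) add0n -scalerBr.
    rewrite [X in 'X_[X]](_ : _ = (U_(j) + (m - U_(i) *+ k))%MM).
      by rewrite subrr scaler0.
    apply/mnmP => t; rewrite !(mnmBE, mnmDE, mulmnE, mnm1E).
    case: (eqVneq i t) => [<-|_]; last by rewrite mul0n !subn0.
    by rewrite eq_sym (negbTE ij) !add0n.
  case: k => [|k] /=; first by rewrite !bin0 !mulm0n !subm0 subrr.
  rewrite hasseX mnmDE mnm1E eqxx add1n binS natrD scalerDl.
  have -> : (U_(i) + m - U_(i) *+ k.+1 = m - U_(i) *+ k)%MM.
    by rewrite mulmS -submDA [(U_(i) + m)%MM]addmC addmK.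
  case: (ltnP k (m i)) => [lt_k|le_k]; last first.
    by rewrite bin_small // !scale0r add0r subr0.
  have -> : (U_(i) + (m - U_(i) *+ k.+1) = m - U_(i) *+ k)%MM.
    apply/mnmP => t; rewrite !(mnmBE, mnmDE, mulmnE, mnm1E).
    case: (eqVneq i t) => [<-|_]; last by rewrite !mul0n !subn0.
    by rewrite !mul1n add1n -subSn.
  by rewrite addrC addKr.
- move=> E; have -> : comm_mul (hasse i k) ('X_j : {mpoly K[n]}) (c *: p) =
      c *: comm_mul (hasse i k) ('X_j : {mpoly K[n]}) p.
    by rewrite /comm_mul -scalerAr !(linZ (@hasse_linear i k)) scalerBr -scalerAr.
  by rewrite E; case: ifP => _; rewrite ?(linZ (@hasse_linear i k.-1)) ?scaler0.
- move=> Ep Eq; have -> : comm_mul (hasse i k) ('X_j : {mpoly K[n]}) (p + q) =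
      comm_mul (hasse i k) ('X_j : {mpoly K[n]}) p +
      comm_mul (hasse i k) ('X_j : {mpoly K[n]}) q.
    by rewrite /comm_mul mulrDr !(linD (@hasse_linear i k)) mulrDr opprD addrACA.
  by rewrite Ep Eq; case: ifP => _; rewrite ?(linD (@hasse_linear i k.-1)) ?addr0.
Qed.

Lemma diff_order_gen k (f : polyalg -> polyalg) : linear f ->
  (forall j : 'I_n, diff_order k (comm_mul f ('X_j : {mpoly K[n]}))) ->
  diff_order k.+1 f.
Proof.
move=> fl fX.
have mul_lin (r : polyalg) : linear ( *%R r) by move=> c x y; rewrite mulrDr -scalerAr.
have mul0 (r : polyalg) : diff_order 0 ( *%R r).
  by move=> s; apply/funext => x; rewrite /comm_mul mulrCA subrr.
have cl (r : polyalg) : linear (comm_mul f r).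
  move=> c x y; rewrite /comm_mul.
  by rewrite mulrDr -scalerAr !fl mulrDr -scalerAr scalerBr opprD addrACA.
pose Q (r : polyalg) := diff_order k (comm_mul f r).
have Q1 : Q 1.
  rewrite /Q (_ : comm_mul f 1 = fun=> 0); first exact: diff_order0.
  by apply/funext => x; rewrite /comm_mul !mul1r subrr.
have QM r s : Q r -> Q s -> Q (r * s).
  move=> Qr Qs; rewrite /Q (_ : comm_mul f (r * s) =
      fun x => (comm_mul f r \o *%R s) x + ( *%R r \o comm_mul f s) x).
    apply: diff_orderD; first by rewrite -[k]addn0; apply: diff_orderM.
    by rewrite -[k]add0n; apply: diff_orderM.
  by apply/funext => x; rewrite /comm_mul /= mulrBr !mulrA addrA subrK.
apply: polyalg_ind => [m|c p Qp|p q Qp Qq].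
- rewrite mpolyXE_id; apply: (big_ind Q) => // i _.
  by elim: (m i) => [|d IH]; rewrite ?expr0 // exprS; apply: QM => //; exact: fX.
- rewrite -/(Q _) -mulr_algl; apply: QM => //; rewrite /Q.
  rewrite (_ : comm_mul f _ = fun=> 0); first exact: diff_order0.
  by apply/funext => x; rewrite /comm_mul !mulr_algl (linZ fl) subrr.
- rewrite (_ : comm_mul f (p + q) = fun x => comm_mul f p x + comm_mul f q x).
    exact: diff_orderD.
  by apply/funext => x; rewrite /comm_mul !mulrDl (linD fl) opprD addrACA.
Qed.

Lemma hasse_order i k : diff_order k (hasse i k).
Proof.
elim: k => [|k IH].
  rewrite (_ : hasse i 0 = id).
    by move=> r; apply/funext => x; rewrite /comm_mul subrr.
  apply/funext => q; apply/mpolyP => m.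
  by rewrite mcoeff_hasse mulm0n addm0 bin0 mulr1.
apply: diff_order_gen => [|j]; first exact: hasse_linear.
by rewrite comm_hasse; case: ifP => _ //; exact: diff_order0.
Qed.

Fact ddiv_subproof i k : hasse i k \in @diffop_pred K polyalg.
Proof.
by apply/asboolP; split; [exact: hasse_linear | exists k; exact: hasse_order].
Qed.

Definition ddiv i k : diffop polyalg := DiffOp (ddiv_subproof i k).

Definition ddivm (b : 'X_{1..n}) : diffop polyalg := \prod_(i < n) ddiv i (b i).

Definition dmono (a b : 'X_{1..n}) : diffop polyalg :=
  mulop ('X_[a] : {mpoly K[n]}) * ddivm b.

(* F_d: the K-span of the x^a \partial^[b] with |a| + |b| <= d *)
Definition dmono_le (d : nat) : set (diffop polyalg) :=
  [set u | exists a b : 'X_{1..n}, (mdeg a + mdeg b <= d)%N /\ u = dmono a b]%classic.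

End DPn.

From mathcomp Require Import all_classical all_reals all_analysis.
Import numFieldNormedType.Exports.
Local Open Scope classical_set_scope.

Section Span.
Variables (K : fieldType) (V : lmodType K).
Implicit Types (S W : set V).

Definition kspan S : set V :=
  [set v | exists (m : nat) (c : 'I_m -> K) (s : 'I_m -> V),
     (forall j, S (s j)) /\ v = \sum_(j < m) c j *: s j].

Definition lin_indep (m : nat) (s : 'I_m -> V) : Prop :=
  forall c : 'I_m -> K, \sum_(j < m) c j *: s j = 0 -> forall j, c j = 0.

Definition has_kdim W (d : nat) : Prop :=
  exists s : 'I_d -> V, lin_indep s /\ W = kspan (range s).

Definition findim W : Prop := exists d, has_kdim W d.

(* 0 if W is not a finite dimensional subspace *)
Definition kdim W : nat := xget 0%N [set d | has_kdim W d].

Definition equiv_filt (X Y : nat -> set V) : Prop :=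
  exists a b c d : nat, [/\ (0 < a)%N, (0 < c)%N &
    \forall i \near \oo, X i `<=` Y (a * i + b)%N /\ Y i `<=` X (c * i + d)%N].

Definition strong_equiv_filt (X Y : nat -> set V) : Prop :=
  exists b d : nat,
    \forall i \near \oo, X i `<=` Y (i + b)%N /\ Y i `<=` X (i + d)%N.

Definition fd_exhaustive (X : nat -> set V) : Prop :=
  [/\ forall i, findim (X i), forall i, X i `<=` X i.+1 &
    \bigcup_i X i = setT].

End Span.

Definition fd_alg_filtration (K : fieldType) (B : algType K)
    (F : nat -> set B) : Prop :=
  [/\ fd_exhaustive F, F 0%N 1 &
    forall i j u v, F i u -> F j v -> F (i + j)%N (u * v)].

(* a B-module seen as a K-vector space *)
Module KRes.
Section Restrict.
Variables (K : fieldType) (B : algType K) (M : lmodType B).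

Definition kres : Type := M.
HB.instance Definition _ := GRing.Zmodule.on kres.

Definition kscale (c : K) (m : kres) : kres := (c%:A : B) *: (m : M).
Fact kscaleA a b m : kscale a (kscale b m) = kscale (a * b) m.
Proof. by rewrite /kscale scalerA mulr_algl scalerA. Qed.
Fact kscale1 : left_id 1 kscale.
Proof. by move=> m; rewrite /kscale !scale1r. Qed.
Fact kscaleDr : right_distributive kscale +%R.
Proof. by move=> a x y; rewrite /kscale scalerDr. Qed.
Fact kscaleDl m : {morph kscale^~ m : a b / a + b}.
Proof. by move=> a b; rewrite /kscale !scalerDl. Qed.
HB.instance Definition _ := GRing.Zmodule_isLmodule.Build K kres
  kscaleA kscale1 kscaleDr kscaleDl.

(* A M_0, the K-span of the products *)
Definition mspan (A : set B) (M0 : set kres) : set kres :=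
  kspan [set (u *: (m : M) : kres) | u in A & m in M0].

Definition generating (M0 : set kres) : Prop :=
  findim M0 /\ mspan setT M0 = setT.

End Restrict.
End KRes.
Export KRes.

Section FinPres.
Variables (B : nzRingType) (N M L : lmodType B).

Definition finitely_presented : Prop :=
  exists (a b : nat) (P : {linear 'rV[B]_a -> M})
    (Q : {linear 'rV[B]_b -> 'rV[B]_a}),
    range P = setT /\ range Q = P @^-1` [set 0].

Definition short_exact (f : {linear N -> M}) (g : {linear M -> L}) : Prop :=
  [/\ injective f, range f = g @^-1` [set 0] & range g = setT].

End FinPres.

Section Dimension.
Variables (K : fieldType) (n : nat).
Local Notation D := (diffop (polyalg K n)).

Definition canonical_filt (i : nat) : set D := kspan (@dmono_le K n i).

Definition standard_alg_filt (F : nat -> set D) : Prop :=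
  fd_alg_filtration F /\ equiv_filt F canonical_filt.

Variable M : lmodType D.

Definition fd_mod_filtration (X : nat -> set (kres M)) : Prop :=
  fd_exhaustive X /\
  exists F, standard_alg_filt F /\
    forall i j (u : D) (m : M), F i u -> X j m -> X (i + j)%N (u *: m).

Definition standard_mod_filt (X : nat -> set (kres M)) : Prop :=
  exists F (M0 : set (kres M)),
    [/\ standard_alg_filt F, generating M0 & forall i, X i = mspan (F i) M0].

Variable R : realType.

Definition growth (f : nat -> nat) : \bar R :=
  ereal_inf [set r%:E | r in
    [set r : R | 0 <= r /\ \forall i \near \oo, (f i)%:R <= i%:R `^ r]].

(* Dim(M) and e(M) are computed from a finite dimensional generating space M0,
   on which they do not depend *)
Definition hilb (M0 : set (kres M)) (i : nat) : nat :=
  kdim (mspan (canonical_filt i) M0).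

Definition Dim (M0 : set (kres M)) : \bar R := growth (hilb M0).

Definition is_mult (M0 : set (kres M)) (e : R) : Prop :=
  exists d : nat, Dim M0 = d%:R%:E /\
    (fun i : nat => (hilb M0 i)%:R : R) =
      (fun i => e / d`!%:R * i%:R ^+ d) +o_\oo (fun i : nat => i%:R ^+ d : R).

(* 0 if e(M) is undefined, which does not happen for finitely presented M *)
Definition mult (M0 : set (kres M)) : R := xget 0 [set e | is_mult M0 e].

End Dimension.

Definition exactly_one (P Q S : Prop) : Prop :=
  [\/ [/\ P, ~ Q & ~ S], [/\ ~ P, Q & ~ S] | [/\ ~ P, ~ Q & S]].

(* Main.v *)
Require Import Defs.
From HB Require Import structures.
From mathcomp Require Import all_boot all_order all_algebra.
From mathcomp Require Import boolp classical_sets functions.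
From mathcomp Require mpoly.
From mathcomp Require Import zify.
Set Implicit Arguments.
Unset Strict Implicit.
Unset Printing Implicit Defensive.

(* Put q = p^k, p = char K, and let D_k be the centralizer of the x_i^q in D = D(P_n).
   Then D is the direct sum of the d^[q g] D_k over the exponents g, and the
   canonical filtration splits accordingly. The relations of a finitely
   presented module M involve finitely many operators, which lie in D_k for
   large k, so M is the direct sum of the d^[q g] M' with M' = D_k M_0. The
   D_k-module M' is spanned by the x^(q a) applied to finitely many vectors. For
   a total order of these vectors compatible with the degree, the standard ones
   (not in the span of the smaller ones) form a basis compatible with the
   filtration, and the non-standard ones are closed under multiplication by
   the x_i^q. Dickson's lemma then has two consequences: the Hilbert function
   dim F_i M_0 is a sum of binomial coefficients in (i - c)/q, and, for M -> L
   with kernel N, reducing the minimal non-standard vectors of L gives finitely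
   many n_j in N with N \cap F_i M_0 included in the sum of the F_i n_j
   (an Artin-Rees property). *)

(** * Counting the complement of a monomial ideal *)

(** What is Noetherian is K[x_1^q, ..., x_n^q], central in D_k, and finite presentation brings the
    problem down to it: a presentation matrix over D_k gives M as D tensored over D_k with M', and D
    is free as a right D_k-module. The centralizer is governed by one identity, (1 + X)^q = 1 + X^q:
    commuting with x_l^q turns d^[b] into d^[b - q e_l], or into 0 when b_l < q. The exponents g are
    unconstrained, so dim F_i M_0 counts complements of monomial ideals in 2n variables whose
    generators avoid the first n; hence a nonzero module has positive dimension. The integer
    division by q leaves no Hilbert polynomial in general, only a leading term, which is all that
    Dim and e see. The generators n_j of N sit in some F_b M_0, which is why the filtration induced
    on N is compared with a standard one only up to a shift by b. *)

Section Counting.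
Implicit Types (n m t d : nat) (a b : seq nat) (U : pred (seq nat)).

Definition lle a b := all2 leq a b.

Definition upset n U := forall a b, size a = n -> lle a b -> U a -> U b.

Lemma lle_refl a : lle a a.
Proof. by elim: a => //= t a ->; rewrite leqnn. Qed.

Lemma lle_size a b : lle a b -> size a = size b.
Proof. by elim: a b => [|t a IH] [|t' b] //= /andP[_ /IH ->]. Qed.

Lemma lle_nth a b i : lle a b -> nth 0 a i <= nth 0 b i.
Proof.
elim: a b i => [|t a IH] [|t' b] [|i] //= /andP[] //.
by move=> _; exact: IH.
Qed.

Lemma upset_cons n U t : upset n.+1 U -> upset n (fun a => U (t :: a)).
Proof. by move=> Uu a b sa ab; apply: Uu; rewrite /= ?sa ?leqnn. Qed.
Arguments upset_cons [n U] t _.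

(* Dickson's lemma *)
Lemma upset_basis n U : upset n U -> exists B : seq (seq nat),
  (forall b, b \in B -> size b = n /\ U b) /\
  forall a, size a = n -> U a -> exists2 b, b \in B & lle b a.
Proof.
elim: n U => [|n IH] U Uu.
  exists (if U [::] then [:: [::]] else [::]); split.
    by move=> b; case: ifP => // U0; rewrite inE => /eqP->.
  by move=> a /size0nil -> ->; exists [::].
have /choice[B BP] t := IH _ (upset_cons t Uu).
(* The union of the slices has a finite basis C by induction. [T] is then chosen so that all of C
   lies in slice T, which makes the slices constant from T on; bases of the slices 0, ..., T
   suffice. *)
pose V a := `[< exists t, U (t :: a) >].
have [|C [CV CP]] := IH V.
  move=> a b sa ab /asboolP[t Ut]; apply/asboolP; exists t.
  by apply: Uu Ut; rewrite /= ?sa ?leqnn.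
have {CV} [T CT] : exists T, forall b, b \in C -> U (T :: b).
  elim: C CV {CP} => [|c C IHC] CV; first by exists 0.
  have [T CT] : exists T, forall b, b \in C -> U (T :: b).
    by apply: IHC => b bC; apply: CV; rewrite inE bC orbT.
  have [sc /asboolP[t Ut]] := CV c (mem_head _ _).
  exists (maxn t T) => b; rewrite inE => /orP[/eqP->|bC].
    by apply: Uu Ut; rewrite /= ?sc ?leq_maxl ?lle_refl.
  have [sb _] := CV b (mem_behead (s := c :: C) bC).
  by apply: Uu (CT b bC); rewrite /= ?sb ?leq_maxr ?lle_refl.
exists (flatten [seq [seq t :: b | b <- B t] | t <- iota 0 T.+1]); split.
  move=> _ /flattenP[_ /mapP[t _ ->] /mapP[b bB ->]].
  by have [/(_ b bB)[<- ?] _] := BP t.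
have key t a : size a = n -> t <= T -> U (t :: a) ->
    exists2 b, b \in B t &
      t :: b \in flatten [seq [seq t :: b | b <- B t] | t <- iota 0 T.+1] /\ lle b a.
  move=> sa tT Ua; have [_ /(_ a sa Ua)[b bB ba]] := BP t.
  exists b => //; split=> //; apply/flattenP; exists [seq t :: b | b <- B t].
    by apply/mapP; exists t => //; rewrite mem_iota.
  exact: map_f.
move=> [//|t a] /= [sa] Ua; have [tT|Tt] := leqP t T.
  by have [b _ [bm ba]] := key t a sa tT Ua; exists (t :: b); rewrite /= ?leqnn.
have [|c cC ca] := CP a sa; first by apply/asboolP; exists t.
have Uc : U (T :: a).
  apply: (Uu (T :: c)); rewrite /= ?leqnn ?(lle_size ca) ?sa //.
  exact: CT.
have [b _ [bm ba]] := key T a sa (leqnn _) Uc.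
by exists (T :: b) => //=; rewrite ba (ltnW Tt).
Qed.

(** T is the largest first exponent in a finite basis: a basis element below [t :: a] is then also
    below [T :: a]. *)
Lemma upset_stable n U : upset n.+1 U ->
  exists T, forall t a, size a = n -> U (t :: a) -> U (T :: a).
Proof.
move=> Uu; have [B [BU BP]] := upset_basis Uu.
exists (\max_(b <- B) head 0 b) => t a sa Ua.
have [|[//|t' b] bB /= /andP[_ ba]] := BP (t :: a) _ Ua; first by rewrite /= sa.
have [sb Ub] := BU _ bB.
apply: Uu Ub => //=; rewrite ba andbT.
exact: (leq_bigmax_seq (F := head 0) (P := predT) _ bB isT).
Qed.

Fixpoint mons n m : seq (seq nat) :=
  if n is n'.+1 then flatten [seq [seq t :: a | a <- mons n' (m - t)] | t <- iota 0 m.+1]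
  else [:: [::]].

Lemma monsS n m :
  mons n.+1 m = flatten [seq [seq t :: a | a <- mons n (m - t)] | t <- iota 0 m.+1].
Proof. by []. Qed.

Lemma mem_mons n m a : (a \in mons n m) = (size a == n) && (sumn a <= m).
Proof.
elim: n m a => [|n IH] m a; first by rewrite inE; case: a.
rewrite monsS; apply/allpairsPdep/andP => [[t [b [tm bm ->]]]|].
  by move: tm bm; rewrite mem_iota IH /= => tm /andP[/eqP-> sb]; split=> //; lia.
case: a => [[]//|t a] [/= sa ta].
have tm : t \in iota 0 m.+1 by rewrite mem_iota; lia.
have am : a \in mons n (m - t) by rewrite IH; move: sa; rewrite eqSS => ->; lia.
by exists t, a.
Qed.

Lemma mons_uniq n m : uniq (mons n m).
Proof.
elim: n m => // n IH m.
rewrite monsS; apply: allpairs_uniq_dep.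
- exact: iota_uniq.
- by move=> t _; exact: IH.
- by move=> [t a] [t' a'] _ _ /= [-> ->].
Qed.

(** A pair (c, d) stands for a polynomial ring in d variables on one generator of degree c, which
    has C(m - c + d, d) monomials of degree at most m. The boolean factor removes the value 1 that
    truncated subtraction would give for m < c. *)
Definition hval (l : seq (nat * nat)) m :=
  \sum_(x <- l) (x.1 <= m) * 'C(m - x.1 + x.2, x.2).

(** Adjoining one variable turns the pair (c, d) into (c, d.+1); the induction on m is Pascal's
    rule. *)
Lemma hockey_stick c d m :
  \sum_(0 <= s < m.+1) (s + c <= m) * 'C(m - (s + c) + d, d) =
  (c <= m) * 'C(m - c + d.+1, d.+1).
Proof.
elim: m c => [|m IH] c.
  rewrite big_nat1 add0n !sub0n !add0n !binn.
  by case: c.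
rewrite big_nat_recl // add0n.
under eq_bigr do rewrite addSn ltnS subSS.
rewrite IH; case: (ltngtP c m.+1) => [lc|gc|->].
- rewrite ltnS in lc; rewrite lc !mul1n subSn // !addSn !addnS binS.
  by rewrite addnC.
- by rewrite leqNgt (ltnW gc).
- by rewrite ltnn subnn !add0n !binn.
Qed.

(* Summing over the first exponent t: the slices are constant from T on. *)
Definition hstep T (l : nat -> seq (nat * nat)) :=
  [seq (x.1 + T, x.2.+1) | x <- l T] ++
  flatten [seq [seq (x.1 + t, x.2) | x <- l t] | t <- iota 0 T].

Lemma hval_step T (h : nat -> nat -> nat) l m :
  (forall t m, h t m = hval (l t) m) -> (forall t m, T <= t -> h t m = h T m) ->
  \sum_(0 <= t < m.+1) h t (m - t) = hval (hstep T l) m.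
Proof.
move=> hl hT.
(* The added terms vanish, and the longer range can be cut at T even when m < T. *)
have -> : \sum_(0 <= t < m.+1) h t (m - t) =
    \sum_(0 <= t < T + m.+1) (t <= m) * h t (m - t).
  rewrite [RHS](big_cat_nat _ (n := m.+1)) ?leq_addl //=.
  rewrite [X in _ + X]big_nat_cond [X in _ + X]big1; last first.
    by move=> t; rewrite andbT => /andP[mt _]; rewrite leqNgt mt.
  rewrite addn0; apply: eq_big_nat => t /andP[_ tm].
  by rewrite -ltnS tm mul1n.
rewrite (big_cat_nat _ (n := T)) ?leq_addr //= addnC.
rewrite /hval big_cat /= big_map big_flatten /= big_map; congr (_ + _).
  rewrite -{1}[T]add0n big_addn addKn.
  transitivity (\sum_(0 <= s < m.+1) \sum_(x <- l T) (s + (x.1 + T) <= m) *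
     'C(m - (s + (x.1 + T)) + x.2, x.2)).
    apply: eq_bigr => s _; rewrite hT ?leq_addl // hl /hval big_distrr /=.
    by apply: eq_bigr => x _; rewrite mulnA; congr (_ * 'C(_ + _, _)); lia.
  rewrite exchange_big /=; apply: eq_bigr => x _; exact: hockey_stick.
rewrite /index_iota subn0; apply: eq_bigr => t _; rewrite big_map hl /hval big_distrr /=.
by apply: eq_bigr => x _; rewrite mulnA; congr (_ * 'C(_ + _, _)); lia.
Qed.

Lemma count_mons_step n (P : pred (seq nat)) m :
  count P (mons n.+1 m) =
  \sum_(0 <= t < m.+1) count (fun a => P (t :: a)) (mons n (m - t)).
Proof.
rewrite monsS count_flatten sumnE !big_map /index_iota subn0.
by apply: eq_bigr => t _; rewrite count_map.
Qed.

(** Slicing along the first exponent lowers n by one: finitely many slices are treated separately,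
    and those from T on, being equal, are summed by [hockey_stick]. *)
Lemma count_mons n U : upset n U ->
  exists l, forall m, count (predC U) (mons n m) = hval l m.
Proof.
elim: n U => [|n IH] U Uu.
  exists (if U [::] then [::] else [:: (0, 0)]) => m.
  rewrite /hval /=; case: (U [::]); first by rewrite big_nil.
  by rewrite big_seq1 /= bin0.
have /choice[l hl] t := IH _ (upset_cons t Uu).
have [T TP] := upset_stable Uu.
exists (hstep T l) => m; rewrite count_mons_step.
apply: (@hval_step T (fun t m => count (predC (fun a => U (t :: a))) (mons n m))) => //.
move=> t k Tt; apply: eq_in_count => a; rewrite mem_mons => /andP[/eqP sa _].
rewrite /=; congr (~~ _); apply/idP/idP; first exact: TP.
by apply: Uu; rewrite /= ?sa ?Tt ?lle_refl.
Qed.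

(** All slices coincide, so [hstep] applies with T = 0 and raises the degree of every binomial by
    one: no constant term remains. *)
Lemma count_mons_cylinder n U : upset n.+1 U ->
  (forall t a, U (t :: a) = U (0 :: a)) ->
  exists l, (forall x, x \in l -> 0 < x.2) /\
    forall m, count (predC U) (mons n.+1 m) = hval l m.
Proof.
move=> Uu U0; have [l hl] := count_mons (upset_cons 0 Uu).
exists (hstep 0 (fun=> l)); split.
  by move=> x; rewrite /hstep cats0 => /mapP[y _ ->].
move=> m; rewrite count_mons_step.
under eq_bigr => t _ do under eq_count => a do rewrite /= U0.
exact: (@hval_step 0 (fun _ m => count (predC (fun a => U (0 :: a))) (mons n m)) (fun=> l)).
Qed.

End Counting.

Import Order.TTheory GRing.Theory Num.Theory.
Local Open Scope classical_set_scope.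
Local Open Scope ring_scope.

(** * Subspaces and dimension *)

Section Subspace.
Variables (K : fieldType) (V : lmodType K).
Implicit Types (S W : set V).

Definition subspace W := W 0 /\ forall c u v, W u -> W v -> W (c *: u + v).

Lemma subspaceZ W c v : subspace W -> W v -> W (c *: v).
Proof. by case=> W0 WD Wv; rewrite -[_ *: _]addr0; apply: WD. Qed.

Lemma subspaceD W u v : subspace W -> W u -> W v -> W (u + v).
Proof. by case=> W0 WD Wu Wv; rewrite -[u]scale1r; apply: WD. Qed.

Lemma subspaceB W u v : subspace W -> W u -> W v -> W (u - v).
Proof. by move=> Ws Wu Wv; rewrite addrC -scaleN1r; apply Ws. Qed.

Lemma subspace_sum W (I : Type) (r : seq I) (P : pred I) (F : I -> V) :
  subspace W -> (forall i, P i -> W (F i)) -> W (\sum_(i <- r | P i) F i).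
Proof.
move=> Ws WF; apply: (big_ind W) => //; first by case: Ws.
by move=> x y; exact: subspaceD.
Qed.

Lemma kspan_subspace S : subspace (kspan S).
Proof.
split.
  by exists 0%N, (fun=> 0), (fun=> 0); split=> [[]//|]; rewrite big_ord0.
move=> c _ _ [m1 [c1 [s1 [Ss1 ->]]]] [m2 [c2 [s2 [Ss2 ->]]]].
exists (m1 + m2)%N.
exists (fun j : 'I_(m1 + m2) => match fintype.split j with inl i => c * c1 i | inr i => c2 i end).
exists (fun j : 'I_(m1 + m2) => match fintype.split j with inl i => s1 i | inr i => s2 i end).
split=> [j|]; first by case: (fintype.split j).
rewrite big_split_ord /= scaler_sumr; congr (_ + _); apply: eq_bigr => i _.
  by rewrite (unsplitK (inl i)) scalerA.
by rewrite (unsplitK (inr i)).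
Qed.
Hint Resolve kspan_subspace : core.

Lemma sub_kspan S : S `<=` kspan S.
Proof.
move=> v Sv; exists 1%N, (fun=> 1), (fun=> v); split=> //.
by rewrite big_ord1 scale1r.
Qed.

Lemma kspan_min S W : subspace W -> S `<=` W -> kspan S `<=` W.
Proof.
move=> Ws SW _ [m [c [s [Ss ->]]]]; apply: subspace_sum => // j _.
by apply: subspaceZ => //; apply: SW.
Qed.

Lemma kspanS S1 S2 : S1 `<=` S2 -> kspan S1 `<=` kspan S2.
Proof. by move=> S12; apply: kspan_min => // v /S12; exact: sub_kspan. Qed.

Lemma kspanU (A B : set V) m : kspan (A `|` B) m ->
  exists a b, [/\ kspan A a, kspan B b & m = a + b].
Proof.
have [A0 _] := kspan_subspace A; have [B0 _] := kspan_subspace B.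
suff : kspan (A `|` B) `<=` [set m | exists a b, [/\ kspan A a, kspan B b & m = a + b]] by apply.
apply: kspan_min; last first.
  move=> x [Ax|Bx].
    by exists x, 0; split=> //; [exact: sub_kspan | rewrite addr0].
  by exists 0, x; split=> //; [exact: sub_kspan | rewrite add0r].
split; first by exists 0, 0; split=> //; rewrite addr0.
move=> c _ _ [a [b [Aa Bb ->]]] [a' [b' [Aa' Bb' ->]]].
exists (c *: a + a'), (c *: b + b'); split; try by apply kspan_subspace.
by rewrite scalerDr addrACA.
Qed.

Lemma kspan_seqP (T : eqType) (s : seq T) (v : T -> V) w : uniq s ->
  kspan (v @` [set` s]) w <-> exists c : T -> K, w = \sum_(x <- s) c x *: v x.
Proof.
move=> us; split; last first.
  move=> [c ->]; rewrite big_seq; apply: subspace_sum => // x xs.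
  by apply: subspaceZ => //; apply: sub_kspan; exists x.
suff: kspan (v @` [set` s]) `<=`
  [set w | exists c : T -> K, w = \sum_(x <- s) c x *: v x] by apply.
apply: kspan_min.
  split; first by exists (fun=> 0); rewrite big1 // => x _; rewrite scale0r.
  move=> a _ _ [c1 ->] [c2 ->]; exists (fun x => a * c1 x + c2 x).
  rewrite scaler_sumr -big_split; apply: eq_bigr => x _ /=.
  by rewrite scalerDl scalerA.
move=> _ [x xs <-]; exists (fun y => (y == x)%:R).
rewrite (bigD1_seq x) //= eqxx scale1r big1 ?addr0 // => y /negbTE ->.
by rewrite scale0r.
Qed.

Definition free_on (T : eqType) (s : seq T) (v : T -> V) :=
  forall c : T -> K, \sum_(x <- s) c x *: v x = 0 -> forall x, x \in s -> c x = 0.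

Lemma has_kdim_seq (T : eqType) (s : seq T) (v : T -> V) : uniq s ->
  free_on s v -> has_kdim (kspan (v @` [set` s])) (size s).
Proof.
move=> us sf; exists (fun j => v (tnth (in_tuple s) j)); split.
  move=> c c0 j.
  pose c' x := odflt 0 (omap c (insub (index x s))).
  have c'E i : c' (tnth (in_tuple s) i) = c i.
    rewrite /c' (tnth_nth (tnth (in_tuple s) i)) /= index_uniq //.
    by rewrite (valK i).
  have {}c0 : \sum_(x <- s) c' x *: v x = 0.
    rewrite -[RHS]c0 (big_nth (tnth (in_tuple s) j)) big_mkord.
    by apply: eq_bigr => i _; rewrite -(tnth_nth _ (in_tuple s)) c'E.
  by rewrite -c'E; apply: (sf _ c0); apply: mem_tnth.
apply/seteqP; split; apply: kspanS => w.
  move=> [x xs <-].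
  have xi : (index x s < size s)%N by rewrite index_mem.
  by exists (Ordinal xi) => //; rewrite (tnth_nth x) /= nth_index.
by move=> [j _ <-]; exists (tnth (in_tuple s) j) => //=; apply: mem_tnth.
Qed.

(** If d < m, the m x d matrix of coordinates has a nonzero left kernel, and a row of that kernel is
    a linear relation between the [s j]. *)
Lemma lin_indep_leq m d (s : 'I_m -> V) W :
  lin_indep s -> (forall j, W (s j)) -> has_kdim W d -> (m <= d)%N.
Proof.
move=> sf sW [t [tf WE]].
have /choice[C CE] j : exists c : 'I_d -> K, s j = \sum_l c l *: t l.
  suff: kspan (range t) `<=` [set w | exists c : 'I_d -> K, w = \sum_l c l *: t l].
    by apply; rewrite -WE.
  apply: kspan_min.
    split; first by exists (fun=> 0); rewrite big1 // => x _; rewrite scale0r.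
    move=> a _ _ [c1 ->] [c2 ->]; exists (fun x => a * c1 x + c2 x).
    rewrite scaler_sumr -big_split; apply: eq_bigr => x _ /=.
    by rewrite scalerDl scalerA.
  move=> _ [x _ <-]; exists (fun y => (y == x)%:R).
  by rewrite (bigD1 x) //= eqxx scale1r big1 ?addr0 // => y /negbTE ->; rewrite scale0r.
pose A := \matrix_(j < m, l < d) C j l.
rewrite leqNgt; apply/negP => lt_dm.
have: row_free A.
  rewrite -kermx_eq0; apply/eqP/row_matrixP => i; rewrite row0.
  have: row i (kermx A) *m A = 0 by apply/sub_kermxP; exact: row_sub.
  move: (row i _) => x xA; apply/rowP => j; rewrite [RHS]mxE.
  apply: (sf (fun j => x 0 j)).
  under eq_bigr do rewrite CE scaler_sumr.
  rewrite exchange_big big1 //= => l _.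
  under eq_bigr do rewrite scalerA.
  rewrite -scaler_suml; have /rowP/(_ l) := xA; rewrite !mxE.
  by under eq_bigr do rewrite mxE; move=> ->; rewrite scale0r.
by rewrite /row_free => /eqP rA; have := rank_leq_col A; rewrite rA leqNgt lt_dm.
Qed.

Lemma has_kdim_leq W1 W2 d1 d2 :
  has_kdim W1 d1 -> has_kdim W2 d2 -> W1 `<=` W2 -> (d1 <= d2)%N.
Proof.
move=> [s [sf ->]] W2d W12; apply: (lin_indep_leq sf _ W2d) => j.
by apply/W12/sub_kspan; exists j.
Qed.

Lemma kdimE W d : has_kdim W d -> kdim W = d.
Proof.
move=> Wd; rewrite /kdim; case: xgetP => [d' _ Wd'|/(_ d)//].
by apply/eqP; rewrite eqn_leq !(@has_kdim_leq W W).
Qed.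

Lemma findimP W : findim W -> has_kdim W (kdim W).
Proof. by move=> [d Wd]; rewrite (kdimE Wd). Qed.

Lemma findim_subspace W : findim W -> subspace W.
Proof. by move=> [d [s [_ ->]]]. Qed.

Lemma kdimS W1 W2 : findim W1 -> findim W2 -> W1 `<=` W2 -> (kdim W1 <= kdim W2)%N.
Proof. by move=> /findimP f1 /findimP f2; exact: has_kdim_leq f1 f2. Qed.

Lemma findim_seq (s : seq V) : findim (kspan [set` s]).
Proof.
suff [t [ut tf <-]] : exists t : seq V, [/\ uniq t, free_on t id &
    kspan [set` t] = kspan [set` s]].
  by exists (size t); rewrite -[X in kspan X]image_id; apply: has_kdim_seq.
elim: s => [|x s [t [ut tf tE]]]; first by exists [::].
have [xs|xNs] := pselect (kspan [set` t] x).
  exists t; split=> //; apply/seteqP; split.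
    by rewrite tE; apply: kspanS => y /= ys; rewrite inE ys orbT.
  apply: kspan_min => // y /=; rewrite inE => /orP[/eqP-> //|ys].
  by rewrite tE; exact: sub_kspan.
exists (x :: t); split => /=.
- by rewrite ut andbT; apply/negP => xt; apply: xNs; exact: sub_kspan.
- move=> c; rewrite big_cons => c0; have cx : c x = 0.
    apply/eqP; apply: contra_notT xNs => cx; rewrite -[x]scale1r -(mulVf cx).
    rewrite -scalerA; apply: subspaceZ => //; rewrite -[_ *: _](addrK (\sum_(j <- t) c j *: j)).
    rewrite c0 add0r -scaleN1r; apply: subspaceZ => //.
    by rewrite big_seq; apply: subspace_sum => // y yt; apply: subspaceZ => //; exact: sub_kspan.
  move: c0; rewrite cx scale0r add0r => /tf ct y.
  by rewrite inE => /orP[/eqP->//|/ct].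
- apply/seteqP; split; apply: kspan_min => // y /=; rewrite inE => /orP[/eqP->|ys].
  + by apply: sub_kspan; rewrite /= mem_head.
  + suff: kspan [set` s] `<=` kspan [set` x :: s].
      by apply; rewrite -tE; exact: sub_kspan.
    by apply: kspanS => z /= zs; rewrite inE zs orbT.
  + by apply: sub_kspan; rewrite /= mem_head.
  + suff: kspan [set` t] `<=` kspan [set` x :: t].
      by apply; rewrite tE; exact: sub_kspan.
    by apply: kspanS => z /= zs; rewrite inE zs orbT.
Qed.

Lemma findim_kspanP W : findim W <-> exists s : seq V, W = kspan [set` s].
Proof.
split=> [[d [s [_ ->]]]|[s ->]]; last exact: findim_seq.
exists [seq s j | j <- enum 'I_d]; congr kspan; apply/seteqP; split=> v.
  by move=> [j _ <-]; apply/mapP; exists j => //; rewrite mem_enum.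
by move=> /mapP[j _ ->]; exists j.
Qed.

End Subspace.
#[export] Hint Resolve kspan_subspace : core.

(** * Linear images, preimages and rank-nullity *)

Section LinearImage.
Variables (K : fieldType) (V V' : lmodType K) (g : V -> V').
Hypothesis gl : linear g.

Lemma linmap0 : g 0 = 0.
Proof. by have := gl (-1) 0 0; rewrite !scaleN1r !addNr. Qed.
Lemma linmapD x y : g (x + y) = g x + g y.
Proof. by have := gl 1 x y; rewrite !scale1r. Qed.
Lemma linmapZ c x : g (c *: x) = c *: g x.
Proof. by have := gl c x 0; rewrite !addr0 linmap0 addr0. Qed.
Lemma linmapB x y : g (x - y) = g x - g y.
Proof. by rewrite addrC -scaleN1r gl scaleN1r addrC. Qed.
Lemma linmap_sum (I : Type) (r : seq I) (F : I -> V) :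
  g (\sum_(i <- r) F i) = \sum_(i <- r) g (F i).
Proof. exact: (big_morph g linmapD linmap0). Qed.

Lemma subspace_preimage (W : set V') : subspace W -> subspace (g @^-1` W).
Proof.
move=> [W0 WD]; split; first by rewrite /preimage /= linmap0.
by move=> c u v Wu Wv; rewrite /preimage /= gl; apply: WD.
Qed.

Lemma subspace_image (W : set V) : subspace W -> subspace (g @` W).
Proof.
move=> [W0 WD]; split; first by exists 0; rewrite ?linmap0.
by move=> c _ _ [u Wu <-] [v Wv <-]; exists (c *: u + v); [exact: WD | exact: gl].
Qed.

Lemma image_kspan (S : set V) : g @` kspan S = kspan (g @` S).
Proof.
apply/seteqP; split.
  move=> _ [v Sv <-]; move: v Sv.
  suff: kspan S `<=` g @^-1` (kspan (g @` S)) by [].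
  apply: kspan_min; first exact: subspace_preimage.
  by move=> v Sv; apply: sub_kspan; exists v.
apply: kspan_min; first exact: subspace_image.
by apply: image_subset; exact: sub_kspan.
Qed.

Lemma findim_image (W : set V) : findim W -> findim (g @` W).
Proof.
move=> /findim_kspanP[s ->]; rewrite image_kspan; apply/findim_kspanP.
exists [seq g x | x <- s]; congr kspan; apply/seteqP; split=> v.
  by move=> [x xs <-]; exact: map_f.
by move=> /mapP[x xs ->]; exists x.
Qed.

Lemma rank_nullity (W : set V) : findim W ->
  findim (W `&` g @^-1` [set 0%R]) /\
  kdim W = (kdim (W `&` g @^-1` [set 0%R]) + kdim (g @` W))%N.
Proof.
move=> Wf; have Ws := findim_subspace Wf.
have [t [tf tE]] := findimP (findim_image Wf).
set l := kdim (g @` W) in t tf tE *.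
have /choice[w /all_and2[wW wt]] j : exists w, W w /\ g w = t j.
  have : (g @` W) (t j) by rewrite tE; apply: sub_kspan; exists j.
  by move=> [x ? ?]; exists x.
have W0s : subspace (W `&` g @^-1` [set 0%R]).
  split; first by split; [case: Ws | exact: linmap0].
  move=> c u v [Wu gu] [Wv gv]; split; first by apply Ws.
  by rewrite /preimage /= gl gu gv scaler0 addr0.
have lift x : W x -> exists c : 'I_l -> K, g (x - \sum_j c j *: w j) = 0.
  move=> Wx; have : kspan (t @` [set` enum 'I_l]) (g x).
    have : (g @` W) (g x) by exists x.
    rewrite tE; apply: kspanS => _ [j _ <-]; exists j => //=; exact: mem_enum.
  rewrite kspan_seqP ?enum_uniq // => -[c cE]; exists c.
  rewrite linmapB linmap_sum cE big_enum /= -sumrB big1 // => j _.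
  by rewrite linmapZ wt subrr.
have W0f : findim (W `&` g @^-1` [set 0%R]).
  have /findim_kspanP[s sE] := Wf.
  have sW x : x \in s -> W x by move=> xs; rewrite sE; exact: sub_kspan.
  have /choice[C CE] x : exists c : 'I_l -> K, W x -> g (x - \sum_j c j *: w j) = 0.
    by case: (pselect (W x)) => [/lift[c cE]|?]; [exists c | exists (fun=> 0)].
  (* The residues of the generators of W span the kernel: a kernel vector is a combination of
     residues plus a combination of the [w j], and applying g kills the latter because the [t j] are
     independent. *)
  pose r x := x - \sum_j C x j *: w j.
  apply/findim_kspanP; exists [seq r x | x <- s].
  apply/seteqP; split; last first.
    apply: kspan_min => // _ /mapP[x xs ->]; split; last by apply: CE; exact: sW.
    apply: subspaceB => //; first exact: sW.
    by apply: subspace_sum => // j _; apply: subspaceZ.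
  move=> x [Wx gx].
  suff [c cE] : exists c : 'I_l -> K,
      kspan [set` [seq r x | x <- s]] (x - \sum_j c j *: w j).
    have -> : x = x - \sum_j c j *: w j; last by [].
    suff c0 j : c j = 0 by rewrite big1 ?subr0 // => j _; rewrite c0 scale0r.
    apply: (tf c _ j); have : g (x - \sum_j c j *: w j) = 0.
      suff : kspan [set` [seq r x | x <- s]] `<=` g @^-1` [set 0%R] by apply.
      apply: kspan_min => [|_ /mapP[y ys ->]]; last by apply: CE; exact: sW.
      by apply: subspace_preimage; split=> // a u v -> ->; rewrite scaler0 addr0.
    rewrite linmapB gx add0r linmap_sum => /eqP; rewrite oppr_eq0 => /eqP E0.
    by rewrite -[RHS]E0; apply: eq_bigr => i _; rewrite linmapZ wt.
  move: Wx; rewrite [in W x -> _]sE; move: x {gx}.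
  suff: kspan [set` s] `<=` [set x | exists c : 'I_l -> K,
      kspan [set` [seq r x | x <- s]] (x - \sum_j c j *: w j)] by [].
  apply: kspan_min => [|x xs]; last first.
    by exists (C x); apply: sub_kspan; exact: (map_f r xs).
  split.
    by exists (fun=> 0); rewrite big1 ?subr0 => [|j _];
      [case: (kspan_subspace [set` [seq r x | x <- s]]) | rewrite scale0r].
  move=> a u v [c1 c1E] [c2 c2E]; exists (fun j => a * c1 j + c2 j).
  have -> : a *: u + v - \sum_j (a * c1 j + c2 j) *: w j =
    a *: (u - \sum_j c1 j *: w j) + (v - \sum_j c2 j *: w j).
    rewrite scalerBr addrACA -opprD scaler_sumr -big_split /=.
    by congr (_ - _); apply: eq_bigr => j _; rewrite scalerDl scalerA.
  by apply kspan_subspace.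
split=> //; have [k0 [k0f k0E]] := findimP W0f.
set k := kdim (W `&` g @^-1` [set 0%R]) in k0 k0f k0E *.
pose b (j : 'I_(k + l)) := match fintype.split j with inl i => k0 i | inr i => w i end.
have k0W i : (W `&` g @^-1` [set 0%R]) (k0 i) by rewrite k0E; apply: sub_kspan; exists i.
apply: kdimE; exists b; split.
  move=> c; rewrite big_split_ord /= => c0.
  have cl i : c (rshift k i) = 0.
    apply: (tf (fun i => c (rshift k i)) _ i).
    have := congr1 g c0; rewrite linmap0 linmapD !linmap_sum big1 ?add0r => [E0|j _].
      by rewrite -[RHS]E0; apply: eq_bigr => j _; rewrite linmapZ /b (unsplitK (inr j)) wt.
    by rewrite linmapZ /b (unsplitK (inl j)); have [_ ->] := k0W j; rewrite scaler0.
  have ck i : c (lshift l i) = 0.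
    apply: (k0f (fun i => c (lshift l i)) _ i); move: c0.
    rewrite [X in _ + X]big1 ?addr0 => [E0|j _]; last by rewrite cl scale0r.
    by rewrite -[RHS]E0; apply: eq_bigr => j _; rewrite /b (unsplitK (inl j)).
  by move=> j; rewrite -[j]splitK; case: (fintype.split j) => i /=; [exact: ck | exact: cl].
apply/seteqP; split.
  move=> x Wx; have [c cE] := lift x Wx.
  rewrite -[x](subrK (\sum_j c j *: w j)); apply: subspaceD => //.
    have : (W `&` g @^-1` [set 0%R]) (x - \sum_j c j *: w j).
      split=> //; apply: subspaceB => //.
      by apply: subspace_sum => // j _; apply: subspaceZ.
    rewrite k0E; apply: kspanS => _ [i _ <-]; exists (lshift l i) => //.
    by rewrite /b (unsplitK (inl i)).
  apply: subspace_sum => // j _; apply: subspaceZ => //; apply: sub_kspan.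
  by exists (rshift k j) => //; rewrite /b (unsplitK (inr j)).
apply: kspan_min => // _ [j _ <-]; rewrite /b; case: (fintype.split j) => i //.
by have [] := k0W i.
Qed.

End LinearImage.

(** * Differential operators on polynomials *)

(* Holds for q = 1, and for q a power of the characteristic of K. *)
Definition pascal_step (K : fieldType) (q : nat) := forall m b,
  'C(q + m, b)%:R = 'C(m, b)%:R + (q <= b)%N%:R * 'C(m, b - q)%:R :> K.

Lemma pascal_step1 (K : fieldType) : pascal_step K 1.
Proof.
move=> m [|b]; first by rewrite !bin0 mul0r addr0.
by rewrite add1n binS subSS subn0 mul1r natrD.
Qed.

(** Compare the coefficients of X^b in (X + 1)^(q + m) = (X^q + 1) (X + 1)^m, the Frobenius identity
    for q = p^k. *)
Lemma pascal_step_pchar (K : fieldType) (p k : nat) :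
  p \in [pchar K] -> pascal_step K (p ^ k).
Proof.
move=> pK m b; set q := (p ^ k)%N.
have pP : p \in [pchar {poly K}] by rewrite pchar_poly.
have coefX1n N j : ((('X : {poly K}) + 1) ^+ N)`_j = 'C(N, j)%:R.
  rewrite exprD1n coef_sum; under eq_bigr do rewrite coefMn coefXn.
  have [jN|Nj] := ltnP j N.+1; last first.
    rewrite bin_small // big1 // => i _.
    by rewrite (gtn_eqF (leq_trans (ltn_ord i) Nj)) mul0rn.
  rewrite (bigD1 (Ordinal jN)) //= eqxx big1 ?addr0 // => i ij.
  by rewrite eq_sym -val_eqE /= in ij; rewrite (negbTE ij) mul0rn.
rewrite -!coefX1n exprD exprDn_pchar ?expr1n; last first.
  by rewrite /q pnatX pnatE ?(pcharf_prime pP) //= pP.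
rewrite mulrDl mul1r coefD addrC coefXnM ltnNge; congr (_ + _).
by case: (q <= b)%N; rewrite /= ?mul1r ?mul0r.
Qed.

Section Operators.
Import mpoly.
Variables (K : fieldType) (n : nat).
Local Notation D := (diffop (polyalg K n)).
Implicit Types (a b m : 'X_{1..n}) (u v : D) (l : 'I_n) (i j q : nat).

Definition xmon a : D := mulop ('X_[a] : {mpoly K[n]}).
Arguments xmon a%_MM.
Definition mbin m b : nat := (\prod_(i < n) 'C(m i, b i))%N.

Lemma dop_xmon a m : dop (xmon a) ('X_[m] : {mpoly K[n]}) = ('X_[a + m] : {mpoly K[n]}).
Proof. by rewrite mpolyXD. Qed.

Lemma xmonD a b : xmon (a + b)%MM = xmon a * xmon b.
Proof. by apply: diffop_eq => x; rewrite dopM /= mpolyXD mulrA. Qed.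

Lemma xmon0 : xmon 0%MM = 1.
Proof. by apply: diffop_eq => x; rewrite dop1 /= mpolyX0 mul1r. Qed.

Lemma diffop_eqX u v :
  (forall m, dop u ('X_[m] : {mpoly K[n]}) = dop v ('X_[m] : {mpoly K[n]})) -> u = v.
Proof.
move=> uv; apply: diffop_eq; apply: polyalg_ind => // [c p E|p r Ep Er].
  by rewrite !(linZ (dop_linear _)) E.
by rewrite !(linD (dop_linear _)) Ep Er.
Qed.

Lemma mbin_small m b : ~~ (b <= m)%MM -> mbin m b = 0%N.
Proof.
rewrite negb_forall => /existsP[l]; rewrite -ltnNge => lt_m.
by rewrite /mbin (bigD1 l) //= bin_small.
Qed.

Lemma dop_ddivm b m : dop (ddivm K b) ('X_[m] : {mpoly K[n]}) =
  (mbin m b)%:R *: ('X_[m - b] : {mpoly K[n]}).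
Proof.
have key (r : seq 'I_n) : uniq r ->
    dop (\prod_(i <- r) ddiv K i (b i)) ('X_[m] : {mpoly K[n]}) =
    (\prod_(i <- r) 'C(m i, b i))%:R *:
      ('X_[m - \big[+%MM/0%MM]_(i <- r) (U_(i) *+ b i)%MM] : {mpoly K[n]}).
  elim: r => [_|l r IH /= /andP[lr ur]].
    by rewrite !big_nil dop1 subm0 scale1r.
  rewrite !big_cons dopM IH // linearZ /= hasseX scalerA mulnC natrM.
  have -> : (m - \big[+%MM/0%MM]_(i <- r) (U_(i) *+ b i))%MM l = m l.
    rewrite mnmBE mnm_sumE big_seq big1 ?subn0 // => i ir.
    by rewrite mulmnE mnm1E; case: eqP lr => [<-|_ _]; rewrite ?ir ?mul0n.
  by rewrite submDA addmC.
by rewrite key ?index_enum_uniq // -multinomUE_id.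
Qed.

Lemma ddivm0 : ddivm K (0%MM : 'X_{1..n}) = 1.
Proof.
apply: diffop_eqX => m; rewrite dop_ddivm dop1 subm0 /mbin big1 ?scale1r // => i _.
by rewrite mnm0E bin0.
Qed.

Lemma bin_mul_bin (M A B : nat) :
  ('C(M, B) * 'C(M - B, A) = 'C(A + B, A) * 'C(M, A + B))%N.
Proof.
have [lt_M|le_M] := ltnP M (A + B).
  rewrite (bin_small lt_M) muln0; have [lt_B|le_B] := ltnP M B.
    by rewrite bin_small.
  by rewrite (@bin_small _ A) ?muln0 // ltn_subLR // addnC.
apply/eqP; rewrite -(eqn_pmul2r (fact_gt0 B)) -(eqn_pmul2r (fact_gt0 A)).
rewrite -(eqn_pmul2r (fact_gt0 (M - (A + B)))); apply/eqP.
have BM : (B <= M)%N by exact: leq_trans (leq_addl _ _) le_M.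
have AMB : (A <= M - B)%N by rewrite leq_subRL // addnC.
move: (bin_fact BM) (bin_fact le_M); rewrite -(bin_fact AMB) -(bin_fact (leq_addr B A)).
rewrite addKn -subnDA [(B + A)%N]addnC; lia.
Qed.

Lemma ddivmM a b : ddivm K a * ddivm K b =
  (\prod_(i < n) 'C(a i + b i, a i))%:R *: ddivm K (a + b)%MM.
Proof.
apply: diffop_eqX => m; rewrite dopM dop_scale !dop_ddivm linearZ /= dop_ddivm.
rewrite submDA [(b + a)%MM]addmC !scalerA -!natrM; congr (_%:R *: _).
rewrite /mbin -!big_split /=; apply: eq_bigr => i _.
by rewrite mnmBE mnmDE bin_mul_bin.
Qed.

Lemma mbin_step q l m b : pascal_step K q ->
  (mbin (U_(l) *+ q + m)%MM b)%:R =
  (mbin m b)%:R + (q <= b l)%N%:R * (mbin m (b - U_(l) *+ q)%MM)%:R :> K.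
Proof.
move=> qP; have mbinD1 (m' b' : 'X_{1..n}) :
    mbin m' b' = ('C(m' l, b' l) * \prod_(i < n | i != l) 'C(m' i, b' i))%N.
  exact: bigD1.
rewrite !mbinD1 !natrM.
rewrite !(mnmDE, mnmBE, mulmnE, mnm1E) eqxx mul1n qP.
have E (b' : 'X_{1..n}) : (forall i : 'I_n, i != l -> b' i = b i) ->
    (\prod_(i < n | i != l) 'C(m i, b' i) = \prod_(i < n | i != l) 'C(m i, b i))%N.
  by move=> bb; apply: eq_bigr => i il; rewrite bb.
rewrite (E (b - U_(l) *+ q)%MM) => [|i il]; last first.
  by rewrite mnmBE mulmnE mnm1E eq_sym (negbTE il) mul0n subn0.
rewrite mulrA -mulrDl; congr (_ * _%:R); apply: eq_bigr => i il.
by rewrite mnmDE mulmnE mnm1E eq_sym (negbTE il).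
Qed.

(** Used with two values of q: q = 1 gives the commutation rule behind the multiplicativity of the
    canonical filtration, and q = p^k determines which divided powers commute with x_l^q. *)
Lemma ddivm_xmonC q l b : pascal_step K q ->
  ddivm K b * xmon (U_(l) *+ q) = xmon (U_(l) *+ q) * ddivm K b +
    (if (q <= b l)%N then ddivm K (b - U_(l) *+ q)%MM else 0).
Proof.
move=> qP; apply: diffop_eqX => m.
rewrite dopD !dopM dop_xmon !dop_ddivm linearZ /= -mpolyXD mbin_step // scalerDl.
congr (_ + _).
  have [bm|/mbin_small ->] := boolP (b <= m)%MM; last by rewrite !scale0r.
  by rewrite -addmBA.
case: leqP => [qb|_]; last by rewrite mul0r scale0r.
rewrite mul1r dop_ddivm; congr (_ *: 'X_[_]); apply/mnmP => i.
rewrite !(mnmDE, mnmBE, mulmnE, mnm1E); case: eqP => [<-|_]; last by rewrite !mul0n subn0.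
by rewrite mul1n subnBA // [(q + _)%N]addnC.
Qed.

Lemma dmonoE a b : dmono K a b = xmon a * ddivm K b.
Proof. by []. Qed.

Local Notation F i := (kspan (@dmono_le K n i)).

Lemma mul_kspanl u (S : set D) v : kspan S v ->
  kspan [set u * w | w in S] (u * v).
Proof.
move=> Sv; rewrite -image_kspan; first by exists v.
by move=> c x y; rewrite mulrDr -scalerAr.
Qed.

Lemma mul_kspanr u (S : set D) v : kspan S v ->
  kspan [set w * u | w in S] (v * u).
Proof.
move=> Sv; rewrite -image_kspan; first by exists v.
by move=> c x y; rewrite mulrDl -scalerAl.
Qed.

Lemma dmono_F a b i : (mdeg a + mdeg b <= i)%N -> F i (dmono K a b).
Proof. by move=> ab; apply: sub_kspan; exists a, b. Qed.

Lemma F_one : F 0 1.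
Proof. by rewrite -[1]mulr1 -{1}xmon0 -ddivm0; apply: dmono_F; rewrite mdeg0. Qed.

Lemma F_leq i j : (i <= j)%N -> F i `<=` F j.
Proof.
move=> ij; apply: kspanS => _ [a [b [ab ->]]].
by exists a, b; split=> //; exact: leq_trans ij.
Qed.

Lemma mdegUB l b : (0 < b l)%N -> (mdeg (b - U_(l))%MM).+1 = mdeg b.
Proof.
move=> bl; have Ub : (U_(l) <= b)%MM by rewrite lep1mP -lt0n.
by rewrite -[in RHS](submK Ub) mdegD mdeg1 addn1.
Qed.

Lemma multinom_ind (P : 'X_{1..n} -> Prop) : P 0%MM ->
  (forall l a, P a -> P (U_(l) + a)%MM) -> forall a, P a.
Proof.
move=> P0 PS a; have [d] := ubnP (mdeg a); elim: d a => // d IH a.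
rewrite ltnS => ad; have [->//|] := eqVneq a 0%MM.
rewrite -mdeg_eq0 mdegE sum_nat_eq0 negb_forall => /existsP[l]; rewrite /= -lt0n => al.
have Ua : (U_(l) <= a)%MM by rewrite lep1mP -lt0n.
by rewrite -(submK Ua) addmC; apply/PS/IH; rewrite mdegUB.
Qed.

Lemma F_ddivm i u b : F i u -> F (i + mdeg b)%N (u * ddivm K b).
Proof.
move=> /(mul_kspanr (ddivm K b)); apply: kspan_min => //.
move=> _ [_ [a [b' [ab ->]] <-]]; rewrite dmonoE -mulrA ddivmM -scalerAr.
apply: subspaceZ => //; apply: dmono_F.
by rewrite mdegD addnA leq_add2r.
Qed.

Lemma F_xmon i u a : F i u -> F (i + mdeg a)%N (u * xmon a).
Proof.
elim/multinom_ind: a i u => [|l a IH] i u Fu.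
  by rewrite xmon0 mulr1 mdeg0 addn0.
rewrite xmonD mulrA mdegD mdeg1 addnA addn1; apply: IH.
move: Fu => /(mul_kspanr (xmon U_(l))); apply: kspan_min => //.
move=> _ [_ [a' [b [ab ->]] <-]]; rewrite dmonoE -mulrA.
rewrite -[U_(l)%MM]mulm1n (ddivm_xmonC _ _ (pascal_step1 K)) mulm1n mulrDr mulrA -xmonD.
apply: subspaceD => //; first by apply: dmono_F; rewrite mdegD mdeg1 addn1 addSn ltnS.
case: ifP => [bl|_]; last by rewrite mulr0; case: (kspan_subspace (@dmono_le K n i.+1)).
apply: dmono_F; apply: leq_trans (leqnSn _).
by apply: leq_trans ab; rewrite leq_add2l -(mdegUB bl).
Qed.

Lemma F_mul i j u v : F i u -> F j v -> F (i + j)%N (u * v).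
Proof.
move=> Fu /(mul_kspanl u); apply: kspan_min => // _ [_ [a [b [ab ->]]] <-].
rewrite dmonoE mulrA; apply: (@F_leq (i + mdeg a + mdeg b)).
  by rewrite -addnA leq_add2l.
by apply: F_ddivm; apply: F_xmon.
Qed.

(** The monomials with the factors in the opposite order: splitting D as the sum of the d^[q g] D_k
    needs the divided powers on the left. *)
Definition dmono_op i : set D :=
  [set u | exists a b : 'X_{1..n}, (mdeg a + mdeg b <= i)%N /\ u = ddivm K b * xmon a].

(** Moving one x_l to the right past d^[b] costs a term with d^[b - e_l], whose total degree is
    smaller by two. *)
Lemma F_sub_op i : F i `<=` kspan (dmono_op i).
Proof.
apply: kspan_min => // _ [a [b [+ ->]]]; rewrite dmonoE.
elim/multinom_ind: a i => [|l a IH] i.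
  by move=> ab; rewrite xmon0 mul1r; apply: sub_kspan; exists 0%MM, b; rewrite xmon0 mulr1.
rewrite mdegD mdeg1 add1n addSn; case: i => // i; rewrite ltnS => /IH.
rewrite xmonD -mulrA => /(mul_kspanl (xmon U_(l))); apply: kspan_min => //.
move=> _ [_ [a' [b' [ab ->]] <-]]; rewrite mulrA.
have := ddivm_xmonC l b' (pascal_step1 K); rewrite mulm1n => E.
rewrite -[xmon _ * _](addrK (if (0 < b' l)%N then ddivm K (b' - U_(l))%MM else 0)) -E.
rewrite mulrBl -mulrA -xmonD; apply: subspaceB => //.
  by apply: sub_kspan; exists (U_(l) + a')%MM, b'; rewrite mdegD mdeg1 add1n addSn.
case: ifP => [bl|_]; last by rewrite mul0r; case: (kspan_subspace (dmono_op i.+1)).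
apply: sub_kspan; exists a', (b' - U_(l))%MM; split=> //.
by rewrite -ltnS -addnS mdegUB // (leq_trans ab) // (leq_trans (leqnSn _)).
Qed.

Lemma F_op a b : F (mdeg b + mdeg a)%N (ddivm K b * xmon a).
Proof.
apply: F_xmon; rewrite -[ddivm K b]mul1r -xmon0 -dmonoE.
by apply: dmono_F; rewrite mdeg0.
Qed.

(** The commutator of f with x_l has order one less and also vanishes on monomials of degree one
    less, so it is 0 by induction; hence f commutes with x_l and its vanishing spreads from x^m to
    x_l x^m. *)
Lemma diff_order_vanish N (f : polyalg K n -> polyalg K n) : linear f -> diff_order N f ->
  (forall m, (mdeg m <= N)%N -> f ('X_[m] : {mpoly K[n]}) = 0) -> forall x, f x = 0.
Proof.
elim: N f => [|N IH] f fl fN f0.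
  move=> x; have /(congr1 (fun g => g 1)) := fN x; rewrite /comm_mul mulr1 => /eqP.
  rewrite subr_eq0 => /eqP->; have := f0 0%MM; rewrite mdeg0 mpolyX0 => ->//.
  by rewrite mulr0.
have fX m : f ('X_[m] : {mpoly K[n]}) = 0.
  elim/multinom_ind: m => [|l m fm]; first by apply: f0; rewrite mdeg0.
  have cl : linear (comm_mul f ('X_l : {mpoly K[n]})).
    move=> c x y; rewrite /comm_mul.
    by rewrite mulrDr -scalerAr !fl mulrDr -scalerAr scalerBr opprD addrACA.
  have := IH _ cl (fN _) _ ('X_[m] : {mpoly K[n]}).
  rewrite /comm_mul -mpolyXD fm mulr0 subr0; apply=> m' m'N.
  by rewrite -mpolyXD !f0 ?mulr0 ?subr0 ?mdegD ?mdeg1 ?(leq_trans m'N).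
apply: polyalg_ind => // [c p fp|p r fp fr]; first by rewrite linZ // fp scaler0.
by rewrite linD // fp fr addr0.
Qed.

Lemma diff_order_mulop (f : polyalg K n) : diff_order 0 (dop (mulop f)).
Proof. by move=> s; apply/funext => x; rewrite /comm_mul /= mulrCA subrr. Qed.

Lemma diff_order_ddivm b : diff_order (mdeg b) (dop (ddivm K b)).
Proof.
rewrite mdegE /ddivm; elim: (index_enum _) => [|l r IH]; rewrite ?big_nil ?big_cons.
  exact: diff_order_mulop.
by apply: (@diff_orderM _ _ _ _ (hasse l (b l))) IH;
  [exact: hasse_linear | exact: dop_linear | exact: hasse_order].
Qed.

Definition F_union : set D := [set u | exists i, F i u].

Lemma F_union_subspace : subspace F_union.
Proof.
split; first by exists 0%N; case: (kspan_subspace (@dmono_le K n 0)).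
move=> c u v [i Fu] [j Fv]; exists (maxn i j).
by apply kspan_subspace; [apply: F_leq Fu; exact: leq_maxl | apply: F_leq Fv; exact: leq_maxr].
Qed.

Lemma F_union_mulop (f : polyalg K n) : F_union (mulop f).
Proof.
move: f; apply: polyalg_ind => [m|c p Fp|p r Fp Fr].
- exists (mdeg m); rewrite -[mulop _]mulr1 -ddivm0.
  by apply: (@dmono_F m 0%MM); rewrite mdeg0 addn0.
- have -> : mulop (c *: p) = c *: mulop p.
    by apply: diffop_eq => x; rewrite dop_scale /= -scalerAl.
  by apply: subspaceZ => //; exact: F_union_subspace.
- have -> : mulop (p + r) = mulop p + mulop r.
    by apply: diffop_eq => x; rewrite dopD /= mulrDl.
  by apply: subspaceD => //; exact: F_union_subspace.
Qed.

(** This links Grothendieck's definition of D to the basis x^a d^[b]: an operator of order at most N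
    is rebuilt from its values on monomials of degree at most N. *)
Lemma F_exhaust u : exists i, F i u.
Proof.
have approx N : exists v, [/\ F_union v, diff_order N.-1 (dop v) &
    forall m, (mdeg m < N)%N -> dop v ('X_[m] : {mpoly K[n]}) = dop u ('X_[m] : {mpoly K[n]})].
  elim: N => [|N [v [Fv vN vu]]].
    by exists 0; split=> //; [case: F_union_subspace | exact: diff_order0].
  (* For |b| = N the operator d^[b] sends x^b to 1 and kills every other monomial of degree at most
     N, so adding the (u - v)(x^b) d^[b] corrects v in degree N without changing it in lower
     degrees. *)
  pose c b : polyalg K n := dop (u - v) ('X_[b] : {mpoly K[n]}).
  exists (v + \sum_(b : 'X_{1..n < N.+1} | mdeg b == N) mulop (c b) * ddivm K b); split.
  - apply: subspaceD => //; first exact: F_union_subspace.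
    apply: subspace_sum => [|b _]; first exact: F_union_subspace.
    have [i Fi] := F_union_mulop (c b); exists (i + mdeg b)%N.
    exact: F_ddivm.
  - apply: diff_orderD; first exact: diff_orderW (leq_pred N) vN.
    apply: (big_ind (fun w : D => diff_order N (dop w))).
    + exact: diff_order0.
    + by move=> x y; exact: diff_orderD.
    + move=> b /eqP bN.
      have := diff_orderM (dop_linear (mulop (c b))) (dop_linear (ddivm K b))
        (diff_order_mulop (c b)) (diff_order_ddivm b).
      by rewrite add0n bN.
  - move=> m mN; rewrite dopD.
    have -> : dop (\sum_(b : 'X_{1..n < N.+1} | mdeg b == N) mulop (c b) * ddivm K b)
        ('X_[m] : {mpoly K[n]}) = if mdeg m == N then c m else 0.
      rewrite (big_morph (fun w : D => dop w ('X_[m] : {mpoly K[n]})) (id1 := 0) (op1 := +%R)) //.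
      have E (b : 'X_{1..n < N.+1}) : mdeg b = N -> bmnm b <> m ->
          dop (mulop (c b) * ddivm K b) ('X_[m] : {mpoly K[n]}) = 0.
        move=> bN bm; rewrite dopM dop_ddivm mbin_small ?scale0r ?linear0 //.
        apply/negP => le_bm; apply: bm; rewrite -(submK le_bm).
        have /eqP -> : (m - b)%MM == 0%MM; last by rewrite add0m.
        rewrite -mdeg_eq0 -(eqn_add2r (mdeg b)) -mdegD submK // add0n bN eqn_leq -ltnS mN.
        rewrite -bN mdegE [X in (_ <= X)%N]mdegE leq_sum // => i _.
        exact: (mnm_lepP le_bm).
      case: eqP => [mE|mNE]; last first.
        by rewrite big1 // => b /eqP bN; apply: E => // bm; apply: mNE; rewrite -bm.
      rewrite (bigD1 (BMultinom mN)); last exact/eqP.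
      rewrite big1; last first.
        move=> b /andP[/eqP bN bm]; apply: E => // bm'; move/eqP: bm; apply.
        exact: val_inj.
      apply: (etrans (addr0 _)).
      change (dop (mulop (c m) * ddivm K m) ('X_[m] : {mpoly K[n]}) = c m).
      rewrite dopM dop_ddivm /mbin big1 ?scale1r => [|i _]; last exact: binn.
      have -> : (m - m)%MM = 0%MM by apply/mnmP => i; rewrite mnmBE mnm0E subnn.
      by rewrite mpolyX0 /= mulr1.
    case: eqP => [_|mE].
      rewrite /c dopD addrCA; change (dop (- v)) with (fun x => - dop v x).
      by rewrite /= subrr addr0.
    by rewrite addr0 vu // ltn_neqAle -ltnS mN andbT; apply/eqP.
case uE : u => [f fd]; have /asboolP[fl [N fN]] := fd; rewrite -uE.
have [v [Fv vN vu]] := approx N.+1; suff -> : u = v by [].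
apply/eqP; rewrite -subr_eq0; apply/eqP; apply: diffop_eq => x.
apply: (@diff_order_vanish N (dop (u - v))); first exact: dop_linear.
  by apply: (@diff_orderB _ _ _ (dop u) (dop v)) => //; rewrite uE.
by move=> m mN; rewrite -[LHS]/(dop u _ - dop v _) vu ?ltnS // subrr.
Qed.

(* For q = p ^ k this is D_k. *)
Definition centr q : set D :=
  [set u | forall l, u * xmon (U_(l) *+ q) = xmon (U_(l) *+ q) * u].

Lemma centr_subspace q : subspace (centr q).
Proof.
split=> [l|c u v uC vC l]; first by rewrite mul0r mulr0.
by rewrite mulrDl mulrDr -scalerAl -scalerAr uC vC.
Qed.

Lemma centrM q u v : centr q u -> centr q v -> centr q (u * v).
Proof. by move=> uC vC l; rewrite -mulrA vC mulrA uC mulrA. Qed.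

Lemma centr_xmon q a : centr q (xmon a).
Proof. by move=> l; rewrite -!xmonD addmC. Qed.

Lemma centr_ddivm q b : pascal_step K q -> (forall l, (b l < q)%N) ->
  centr q (ddivm K b).
Proof. by move=> qP bq l; rewrite ddivm_xmonC // leqNgt bq addr0. Qed.

(** All exponents of divided powers occurring in F_i are at most i < q. Since the F_i exhaust D,
    every operator lies in D_k for k large. *)
Lemma centr_F q i u : pascal_step K q -> (i < q)%N -> F i u -> centr q u.
Proof.
move=> qP iq; apply: kspan_min; first exact: centr_subspace.
move=> _ [a [b [ab ->]]]; rewrite dmonoE; apply: centrM; first exact: centr_xmon.
apply: centr_ddivm => // l; apply: leq_ltn_trans iq; apply: leq_trans ab.
by apply: leq_trans (leq_addl _ _); rewrite mdegE (bigD1 l) //= leq_addr.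
Qed.

(* Commuting with x_l^q shifts the exponents of the divided powers. *)
Lemma ddivm_centr_free q (r : seq 'X_{1..n}) (c : 'X_{1..n} -> D) :
  (0 < q)%N -> pascal_step K q -> uniq r -> (forall g, g \in r -> centr q (c g)) ->
  \sum_(g <- r) ddivm K (g *+ q)%MM * c g = 0 -> forall g, g \in r -> c g = 0.
Proof.
move=> q0 qP; have [d rd] : exists d, forall g, g \in r -> (mdeg g < d)%N.
  exists (\max_(g <- r) mdeg g).+1 => g gr; rewrite ltnS.
  exact: (leq_bigmax_seq (F := mdeg) (P := predT) _ gr isT).
elim: d r c rd => [|d IH] r c rd ur cC c0; first by move=> g /rd.
(* The commutator of the relation with x_l^q loses the terms with g_l = 0 and moves the others from
   g to g - e_l: a relation of smaller degree with the same coefficients. *)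
have cpos l g : g \in r -> (0 < g l)%N -> c g = 0.
  move=> gr gl; pose rl := [seq (g - U_(l))%MM | g : 'X_{1..n} <- r & (0 < g l)%N].
  have subUK (g' : 'X_{1..n}) : (0 < g' l)%N -> (g' - U_(l) + U_(l))%MM = g'.
    by move=> g'l; apply: submK; rewrite lep1mP -lt0n.
  have rlP g' : g' \in rl -> (g' + U_(l))%MM \in r.
    by move=> /mapP[h]; rewrite mem_filter => /andP[hl hr] ->; rewrite subUK.
  rewrite -(subUK g gl); apply: (IH rl (fun g => c (g + U_(l))%MM)).
  - move=> g1 /mapP[h]; rewrite mem_filter => /andP[hl hr] ->.
    by rewrite -ltnS mdegUB // rd.
  - rewrite map_inj_in_uniq ?filter_uniq // => h h'; rewrite !mem_filter.
    by move=> /andP[hl _] /andP[hl' _] /(congr1 (fun x => x + U_(l))%MM); rewrite !subUK.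
  - by move=> h /rlP; exact: cC.
  - rewrite big_map big_filter /=.
    transitivity ((\sum_(h <- r) ddivm K (h *+ q)%MM * c h) * xmon (U_(l) *+ q) -
        xmon (U_(l) *+ q) * (\sum_(h <- r) ddivm K (h *+ q)%MM * c h)); last first.
      by rewrite c0 mul0r mulr0 subrr.
    rewrite mulr_suml mulr_sumr -sumrB [LHS]big_mkcond /= 2!big_seq.
    apply: eq_bigr => h hr; rewrite -mulrA cC // mulrA ddivm_xmonC // mulrDl mulrA.
    rewrite [RHS]addrAC subrr add0r mulmnE.
    have -> : (q <= h l * q)%N = (0 < h l)%N by rewrite -{1}[q]mul1n leq_pmul2r.
    case: ifP => hl; last by rewrite mul0r.
    rewrite subUK //; congr (ddivm K _ * _); apply/mnmP => i.
    by rewrite !(mulmnE, mnmBE) mulnBl.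
  - by apply: map_f; rewrite mem_filter gl.
(* Only g = 0 is left; there d^[0] = 1 and the relation itself reads c 0 = 0. *)
move=> g gr; have [g0|] := eqVneq g 0%MM; last first.
  rewrite -mdeg_eq0 mdegE sum_nat_eq0 negb_forall => /existsP[l]; rewrite /= -lt0n.
  exact: cpos.
move: c0; rewrite (bigD1_seq g) //= big_seq_cond big1 => [|h /andP[hr hg]].
  rewrite addr0 g0 => <-; rewrite (_ : 0 *+ q = 0)%MM ?ddivm0 ?mul1r //.
  by apply/mnmP => i; rewrite mulmnE mnm0E mul0n.
have : h != 0%MM by rewrite -g0.
rewrite -mdeg_eq0 mdegE sum_nat_eq0 negb_forall => /existsP[l]; rewrite /= -lt0n.
by move=> /(cpos l h hr) ->; rewrite mulr0.
Qed.

Definition mdivq q b : 'X_{1..n} := [multinom (b i %/ q)%N | i < n].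
Definition mmodq q b : 'X_{1..n} := [multinom (b i %% q)%N | i < n].

Lemma mdivq_eq q b : b = (mdivq q b *+ q + mmodq q b)%MM.
Proof. by apply/mnmP => i; rewrite mnmDE mulmnE !mnmE -divn_eq. Qed.

Lemma mmodq_lt q b l : (0 < q)%N -> (mmodq q b l < q)%N.
Proof. by rewrite mnmE ltn_mod. Qed.

(* Lucas: the binomial coefficients C(q g_i + b_i, q g_i) are 1 in K. *)
Lemma ddivm_divq q (g b : 'X_{1..n}) : pascal_step K q -> (forall l, (b l < q)%N) ->
  ddivm K (g *+ q + b)%MM = ddivm K (g *+ q)%MM * ddivm K b.
Proof.
move=> qP bq; rewrite ddivmM natr_prod big1 ?scale1r // => l _.
rewrite mulmnE -bin_sub ?leq_addr // addKn.
elim: (g l) => [|t IH]; first by rewrite mul0n add0n binn.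
by rewrite mulSn -addnA qP IH leqNgt bq mul0r addr0.
Qed.

(** Both exponents are divided by q with remainder, and d^[b mod q] is moved past the power of the
    x_l^q with which it commutes. The remainders range over a finite set, the source of the finitely
    many vectors spanning M' over K[x_1^q, ..., x_n^q]. *)
Lemma ddivm_xmon_split q a b : (0 < q)%N -> pascal_step K q ->
  ddivm K b * xmon a = ddivm K (mdivq q b *+ q)%MM *
    (xmon (mdivq q a *+ q) * (ddivm K (mmodq q b) * xmon (mmodq q a))).
Proof.
move=> q0 qP; rewrite {1}(mdivq_eq q b) ddivm_divq //; last by move=> l; exact: mmodq_lt.
rewrite {1}(mdivq_eq q a) xmonD -!mulrA; congr (_ * _); rewrite !mulrA; congr (_ * _).
have bC : centr q (ddivm K (mmodq q b)) by apply: centr_ddivm => // l; exact: mmodq_lt.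
suff : forall g, ddivm K (mmodq q b) * xmon (g *+ q) = xmon (g *+ q) * ddivm K (mmodq q b).
  by apply.
elim/multinom_ind => [|l g IH].
  rewrite (_ : 0 *+ q = 0)%MM ?xmon0 ?mulr1 ?mul1r //.
  by apply/mnmP => i; rewrite mulmnE mnm0E mul0n.
rewrite (_ : (U_(l) + g) *+ q = U_(l) *+ q + g *+ q)%MM; last first.
  by apply/mnmP => i; rewrite !(mulmnE, mnmDE) mulnDl.
by rewrite xmonD mulrA bC -!mulrA IH.
Qed.

Lemma mdeg_divq q a : mdeg a = (mdeg (mdivq q a) * q + mdeg (mmodq q a))%N.
Proof. by rewrite {1}(mdivq_eq q a) mdegD mdegMn. Qed.

End Operators.

(** * Standard monomials *)

Section Standard.
Variables (T : eqType) (lt : rel T) (below : T -> seq T).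
Hypotheses (lt_irr : irreflexive lt) (lt_trans : transitive lt).
Hypothesis lt_total : forall x y, x != y -> lt x y || lt y x.
Hypothesis mem_below : forall x y, lt y x -> y \in below x.
Hypothesis sub_below : forall x y, lt y x -> {subset below y <= below x}.

(** The set of indices below x is finite by [mem_below], and it strictly shrinks when x is replaced
    by a smaller y, since y itself drops out. *)
Lemma lt_ind (P : T -> Prop) :
  (forall x, (forall y, lt y x -> P y) -> P x) -> forall x, P x.
Proof.
move=> IH x; have [N] := ubnP (size [seq y <- undup (below x) | lt y x]).
elim: N x => // N IHN x; rewrite ltnS => xN; apply: IH => y yx; apply: IHN.
apply: leq_trans xN; rewrite -[X in (X < _)%N]/(size [seq _ <- _ | _]).
have ys : y \in [seq z <- undup (below x) | lt z x].
  by rewrite mem_filter yx mem_undup mem_below.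
have uy : uniq (y :: [seq z <- undup (below y) | lt z y]).
  by rewrite /= mem_filter lt_irr filter_uniq ?undup_uniq.
apply: (uniq_leq_size uy) => z; rewrite inE => /orP[/eqP-> //|].
rewrite !mem_filter !mem_undup => /andP[zy zb].
by rewrite (lt_trans zy yx) (sub_below yx zb).
Qed.

Lemma seq_max (s : seq T) : s != [::] ->
  exists2 x, x \in s & forall y, y \in s -> y != x -> lt y x.
Proof.
elim: s => // x s IH _; have [->|/IH[y ys ymax]] := eqVneq s [::].
  by exists x => [|y]; rewrite inE // => ->.
have [->|xy] := eqVneq x y.
  by exists y => [|z]; rewrite inE ?eqxx // => /orP[->//|]; exact: ymax.
have /orP[lxy|lyx] := lt_total xy.
  exists y => [|z]; first by rewrite inE ys orbT.
  by rewrite inE => /orP[/eqP->//|]; exact: ymax.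
exists x => [|z]; first by rewrite mem_head.
rewrite inE => /orP[->//|zs] _; have [->//|zy] := eqVneq z y.
by apply: lt_trans lyx; exact: ymax.
Qed.

Variables (K : fieldType) (V : lmodType K) (v : T -> V).

(** Macaulay's standard monomials, with [lt] as term order. *)
Definition std x := ~ kspan (v @` [set y | lt y x]) (v x).

(** In a relation, the largest index with nonzero coefficient would be expressed by smaller ones. *)
Lemma std_free (s : seq T) : uniq s -> (forall x, x \in s -> std x) -> free_on s v.
Proof.
move=> us ss c c0 x xs; apply/eqP; apply: contrapT => /negP cx.
have [|y] := @seq_max [seq y <- s | c y != 0].
  by apply/negP => /eqP /(congr1 (fun t => x \in t)); rewrite mem_filter cx xs.
rewrite mem_filter => /andP[cy ys] ymax; apply: (ss y ys).
move: c0; rewrite (bigD1_seq y) //= => /eqP; rewrite addr_eq0 => /eqP E.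
rewrite -[v y]scale1r -(mulVf cy) -scalerA E -scaleN1r scalerA.
apply: subspaceZ => //; rewrite big_seq_cond; apply: subspace_sum => // z /andP[zs zy].
have [->|cz] := eqVneq (c z) 0.
  by rewrite scale0r; case: (kspan_subspace (v @` [set z | lt z y])).
apply: subspaceZ => //; apply: sub_kspan; exists z => //=.
by apply: ymax zy; rewrite mem_filter cz.
Qed.

(** The bound on the indices matters: for an order refining the degree it makes the standard basis
    compatible with the filtration. *)
Lemma std_span x : kspan (v @` [set y | std y /\ (y = x \/ lt y x)]) (v x).
Proof.
elim/lt_ind: x => x IH; have [xs|xs] := pselect (std x).
  by apply: sub_kspan; exists x => //; split=> //; left.
have {xs} : kspan (v @` [set y | lt y x]) (v x) by exact: contrapT.
apply: kspan_min => // _ [y yx <-]; have := IH y yx; apply: kspanS.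
move=> _ [z [zs zy] <-]; exists z => //; split=> //; right.
by case: zy => [->//|/lt_trans]; apply.
Qed.

End Standard.

(** * Modules over differential operators *)

Section Action.
Variables (K : fieldType) (B : algType K) (M : lmodType B).
Implicit Types (u v : B) (m : kres M) (A : set B) (S : set (kres M)).

Definition act u m : kres M := u *: (m : M).

Lemma actM u v m : act (u * v) m = act u (act v m).
Proof. by rewrite /act scalerA. Qed.
Lemma actDl u v m : act (u + v) m = act u m + act v m.
Proof. exact: (@scalerDl _ M). Qed.
Lemma act0l m : act 0 m = 0.
Proof. exact: (@scale0r _ M). Qed.
Lemma act0r u : act u 0 = 0.
Proof. exact: (@scaler0 _ M). Qed.
Lemma actZ c m : c *: m = act (c%:A) m.
Proof. by []. Qed.
Lemma actZl c u m : act (c *: u) m = c *: act u m.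
Proof. by rewrite actZ -actM mulr_algl. Qed.
Lemma actZr c u m : act u (c *: m) = c *: act u m.
Proof. by rewrite actZ -actM -actZl mulr_algr. Qed.
Lemma act_linear u : linear (act u).
Proof. by move=> c x y; rewrite -actZr; exact: (@scalerDr _ M). Qed.
Lemma act_suml (I : Type) (r : seq I) (P : pred I) (F : I -> B) m :
  act (\sum_(i <- r | P i) F i) m = \sum_(i <- r | P i) act (F i) m.
Proof. exact: (@scaler_suml _ M). Qed.
Lemma act_sumr (I : Type) (r : seq I) (P : pred I) (F : I -> kres M) u :
  act u (\sum_(i <- r | P i) F i) = \sum_(i <- r | P i) act u (F i).
Proof. exact: (@scaler_sumr _ M). Qed.

Lemma mspan_subspace A S : subspace (mspan A S).
Proof. exact: kspan_subspace. Qed.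

Lemma mspan_act A S u m : A u -> S m -> mspan A S (act u m).
Proof. by move=> Au Sm; apply: sub_kspan; exists u => //; exists m. Qed.

Lemma mspan_min A S W : subspace W -> (forall u m, A u -> S m -> W (act u m)) ->
  mspan A S `<=` W.
Proof. by move=> Ws AS; apply: kspan_min => // _ [u Au [m Sm <-]]; exact: AS. Qed.

Lemma mspan_kspanl A S : mspan (kspan A) S = mspan A S.
Proof.
apply/seteqP; split; last first.
  apply: mspan_min; first exact: mspan_subspace.
  by move=> u m Au Sm; apply: mspan_act => //; exact: sub_kspan.
apply: mspan_min; first exact: mspan_subspace.
move=> u m + Sm; move: u.
suff : kspan A `<=` [set u | mspan A S (act u m)] by [].
apply: kspan_min; last by move=> u Au; exact: mspan_act.
split; first by rewrite /= act0l; case: (mspan_subspace A S).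
by move=> c u v /= Wu Wv; rewrite actDl actZl; apply mspan_subspace.
Qed.

Lemma mspan_kspanr A S : mspan A (kspan S) = mspan A S.
Proof.
apply/seteqP; split; last first.
  apply: mspan_min; first exact: mspan_subspace.
  by move=> u m Au Sm; apply: mspan_act => //; exact: sub_kspan.
apply: mspan_min; first exact: mspan_subspace.
move=> u m Au; move: m.
suff : kspan S `<=` act u @^-1` mspan A S by [].
apply: kspan_min; last by move=> m Sm; exact: mspan_act.
by apply: subspace_preimage; [exact: act_linear | exact: mspan_subspace].
Qed.

Lemma mspanS A A' S S' : A `<=` A' -> S `<=` S' -> mspan A S `<=` mspan A' S'.
Proof.
move=> AA SS; apply: mspan_min; first exact: mspan_subspace.
by move=> u m /AA Au /SS Sm; exact: mspan_act.
Qed.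

End Action.

Section ModuleMap.
Variables (K : fieldType) (B : algType K) (M L : lmodType B) (g : {linear M -> L}).

Definition kmap (m : kres M) : kres L := g (m : M).

Lemma kmap_act u m : kmap (act u m) = act u (kmap m).
Proof. exact: linearZ. Qed.

Lemma kmap_linear : linear kmap.
Proof. by move=> c x y; rewrite /kmap [LHS]linearD; congr (_ + _); exact: kmap_act. Qed.

Lemma kmap_mspan A S : kmap @` mspan A S = mspan A (kmap @` S).
Proof.
rewrite /mspan image_kspan; last exact: kmap_linear.
congr kspan; apply/seteqP; split=> [_ [_ [u Au [m Sm <-]] <-]|_ [u Au [_ [m Sm <-] <-]]].
  by exists u => //; exists (kmap m); [exists m | exact: (esym (kmap_act u m))].
by exists (act u m); [exists u => //; exists m | exact: kmap_act].
Qed.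

End ModuleMap.

(** * Splitting finitely presented modules over the centralizer *)

Section Free.
Import mpoly.
Variables (K : fieldType) (n : nat).
Local Notation D := (diffop (polyalg K n)).
Local Notation F i := (kspan (@dmono_le K n i)).

Definition mnm_seq (s : seq nat) : 'X_{1..n} := [multinom nth 0%N s i | i < n].

Lemma mnm_seqK (a : 'X_{1..n}) : mnm_seq a = a.
Proof. by apply/mnmP => i; rewrite mnmE -mnm_nth. Qed.

Lemma seq_mnmK (s : seq nat) : size s = n -> mnm_seq s = s :> seq nat.
Proof.
move=> sn; apply: (@eq_from_nth _ 0%N) => [|i]; first by rewrite size_tuple sn.
by rewrite size_tuple => i_n; rewrite -(mnm_nth _ _ (Ordinal i_n)) mnmE.
Qed.

Lemma mdeg_sumn (a : 'X_{1..n}) : mdeg a = sumn a.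
Proof. by rewrite /mdeg sumnE. Qed.

Definition mnms i : seq 'X_{1..n} := [seq mnm_seq s | s <- mons n i].

Lemma mem_mnms i a : (a \in mnms i) = (mdeg a <= i)%N.
Proof.
apply/mapP/idP => [[s + ->]|ai].
  by rewrite mem_mons => /andP[/eqP sn si]; rewrite mdeg_sumn seq_mnmK.
by exists (a : seq nat); rewrite ?mnm_seqK // mem_mons size_tuple eqxx -mdeg_sumn.
Qed.

Lemma mnms_uniq i : uniq (mnms i).
Proof.
rewrite map_inj_in_uniq ?mons_uniq // => s t; rewrite !mem_mons.
by move=> /andP[/eqP sn _] /andP[/eqP tn _] E; rewrite -(seq_mnmK sn) -(seq_mnmK tn) E.
Qed.

Lemma findim_F i : findim (F i).
Proof.
apply/findim_kspanP; exists [seq dmono K a b | a <- mnms i, b <- mnms (i - mdeg a)].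
congr kspan; apply/seteqP; split=> u.
  move=> [a [b [ab ->]]]; apply: allpairs_f_dep; rewrite mem_mnms; lia.
move=> /allpairsPdep[a [b []]]; rewrite !mem_mnms => ai bi ->.
by exists a, b; split=> //; lia.
Qed.

Lemma centr_decomp q i (u : D) : (0 < q)%N -> pascal_step K q -> F i u ->
  exists c : 'X_{1..n} -> D, (forall g, centr q (c g)) /\
    u = \sum_(g <- mnms i) ddivm K (g *+ q)%MM * c g.
Proof.
move=> q0 qP /F_sub_op; move: u.
suff : kspan (dmono_op i) `<=` [set u | exists c : 'X_{1..n} -> D,
  (forall g, centr q (c g)) /\ u = \sum_(g <- mnms i) ddivm K (g *+ q)%MM * c g] by [].
apply: kspan_min.
  split.
    exists (fun=> 0); split=> [_|]; first by case: (centr_subspace K n q).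
    by rewrite big1 // => g _; rewrite mulr0.
  move=> a _ _ [c1 [c1C ->]] [c2 [c2C ->]]; exists (fun g => a *: c1 g + c2 g); split.
    by move=> g; apply centr_subspace.
  rewrite scaler_sumr -big_split; apply: eq_bigr => g _.
  by rewrite mulrDr scalerAr.
move=> _ [a [b [ab ->]]].
exists (fun g => if g == mdivq q b then
  xmon K (mdivq q a *+ q)%MM * (ddivm K (mmodq q b) * xmon K (mmodq q a)) else 0); split.
  move=> g; case: eqP => _; last by case: (centr_subspace K n q).
  apply: centrM; first exact: centr_xmon.
  by apply: centrM; [apply: centr_ddivm => // l; exact: mmodq_lt | exact: centr_xmon].
have bm : mdivq q b \in mnms i.
  rewrite mem_mnms; apply: leq_trans ab; apply: leq_trans (leq_addl _ _).
  rewrite [X in (_ <= X)%N](mdeg_divq q) (leq_trans _ (leq_addr _ _)) //.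
  by rewrite leq_pmulr.
rewrite (bigD1_seq (mdivq q b)) ?mnms_uniq //= eqxx -ddivm_xmon_split //.
by rewrite big1 ?addr0 // => g /negbTE ->; rewrite mulr0.
Qed.

Section Family.
Variables (M : lmodType D) (r : nat) (s : 'I_r -> kres M).

Definition centr_span q : set (kres M) :=
  [set m | exists d : 'I_r -> D, (forall j, centr q (d j)) /\ m = \sum_j act (d j) (s j)].

(* The sum of the d^[q g] W is direct and d^[q g] is injective on W. *)
Definition ddiv_free q (W : set (kres M)) :=
  forall (R : seq 'X_{1..n}) (c : 'X_{1..n} -> kres M),
  uniq R -> (forall g, g \in R -> W (c g)) ->
  \sum_(g <- R) act (ddivm K (g *+ q)%MM) (c g) = 0 -> forall g, g \in R -> c g = 0.

End Family.

Lemma centr_large (p : nat) (I : finType) (u : I -> D) : p \in [pchar K] ->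
  exists k0, forall k, (k0 <= k)%N -> forall i, centr (p ^ k) (u i).
Proof.
move=> pK; have /choice[d dF] i := F_exhaust (u i).
exists (\max_i d i)%N => k dk i; apply: (centr_F _ _ (dF i)).
  exact: pascal_step_pchar.
apply: leq_ltn_trans (leq_bigmax i) _; apply: leq_ltn_trans dk _.
by rewrite ltn_expl // prime_gt1 // (pcharf_prime pK).
Qed.

(** Once k is so large that the relation matrix and the chosen lifts of [s] have entries in D_k, any
    relation between the d^[q g] c_g can be compared coefficient by coefficient, because D is free
    over D_k on the d^[q g]. *)
Lemma fp_ddiv_free (p : nat) (M : lmodType D) : p \in [pchar K] -> finitely_presented M ->
  forall (r : nat) (s : 'I_r -> kres M),
  exists k0, forall k, (k0 <= k)%N -> ddiv_free (p ^ k) (centr_span s (p ^ k)).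
Proof.
move=> pK [a [b [P [Q [Psurj QP]]]]] r s.
have /choice[E EP] i : exists e : 'rV[D]_a, P e = s i.
  have : (range P) (s i : M) by rewrite Psurj.
  by move=> [e _ <-]; exists e.
have [k1 Ek] := centr_large (fun ij : 'I_r * 'I_a => E ij.1 0 ij.2) pK.
have [k2 Rk] := centr_large (fun tj : 'I_b * 'I_a => Q (delta_mx 0 tj.1) 0 tj.2) pK.
exists (maxn k1 k2) => k; rewrite geq_max => /andP[/Ek {}Ek /Rk {}Rk].
set q := (p ^ k)%N in Ek Rk *.
have q0 : (0 < q)%N by rewrite expn_gt0 prime_gt0 // (pcharf_prime pK).
have qP : pascal_step K q by exact: pascal_step_pchar.
pose u j : kres M := P (delta_mx 0 j).
have PE (e : 'rV[D]_a) : P e = \sum_j act (e 0 j) (u j).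
  rewrite {1}(row_sum_delta e) linear_sum; apply: eq_bigr => j _.
  exact: linearZ.
move=> R c uR cW c0.
(* Coordinates of [c g] on the generators of M; they are set to 0 outside R so that sums over R
   extend to a longer list. *)
have /choice[d dP] g : exists d : 'I_a -> D, (forall j, centr q (d j)) /\
    (g \in R -> c g = \sum_j act (d j) (u j)) /\ (g \notin R -> d = fun=> 0).
  have [gR|gR] := boolP (g \in R); last first.
    by exists (fun=> 0); split=> // j; case: (centr_subspace K n q).
  have [d [dC dE]] := cW g gR.
  exists (fun j => \sum_i d i * E i 0 j); split=> [j|].
    apply: subspace_sum => [|i _]; first exact: centr_subspace.
    by apply: centrM => //; exact: (Ek (i, j)).
  split=> // _; rewrite dE; under eq_bigr do rewrite -EP PE act_sumr.
  rewrite exchange_big /=; apply: eq_bigr => j _; rewrite act_suml.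
  by apply: eq_bigr => i _; rewrite actM.
have rel t : \sum_j act (Q (delta_mx 0 t) 0 j) (u j) = 0.
  rewrite -PE; have : (P @^-1` [set 0%R]) (Q (delta_mx 0 t)); last by [].
  by rewrite -QP; exists (delta_mx 0 t).
(* The vanishing sum says P e = 0, so exactness of the presentation gives e = Q w. *)
pose e : 'rV[D]_a := \row_j \sum_(g <- R) ddivm K (g *+ q)%MM * d g j.
have [w _ wE] : range Q e.
  rewrite QP /preimage /= PE -[RHS]c0.
  under eq_bigr do rewrite mxE act_suml.
  rewrite exchange_big big_seq [RHS]big_seq /=; apply: eq_bigr => g gR.
  have [_ [-> // _]] := dP g; rewrite act_sumr.
  by apply: eq_bigr => j _; rewrite actM.
have /choice[iw wF] t := F_exhaust (w 0 t).
(* N bounds both the exponents in R and those in the decomposition of w, so that one list indexes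
   both sides. *)
pose N := maxn (\max_t iw t) (\max_(g <- R) mdeg g).
have /choice[wc /all_and2[wcC wcE]] t : exists c : 'X_{1..n} -> D,
    (forall g, centr q (c g)) /\ w 0 t = \sum_(g <- mnms N) ddivm K (g *+ q)%MM * c g.
  apply: centr_decomp => //; apply: F_leq (wF t).
  by rewrite leq_max (leq_bigmax t).
have eE j : \sum_(g <- mnms N) ddivm K (g *+ q)%MM * d g j =
    \sum_(g <- mnms N) ddivm K (g *+ q)%MM * \sum_t wc t g * Q (delta_mx 0 t) 0 j.
  transitivity (e 0 j).
    rewrite mxE [LHS](bigID (mem R)) /= [X in _ + X]big1 ?addr0 => [|g gR]; last first.
      by have [_ [_ ->]] := dP g; rewrite ?mulr0.
    rewrite -big_filter; apply: perm_big; apply: uniq_perm => //.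
      by rewrite filter_uniq ?mnms_uniq.
    move=> g; rewrite mem_filter mem_mnms; case: (boolP (g \in R)) => //= gR.
    by rewrite leq_max (leq_bigmax_seq (F := mdeg) (P := predT) _ gR isT) orbT.
  rewrite -wE {1}(row_sum_delta w) linear_sum summxE.
  under eq_bigr do rewrite linearZ mxE wcE mulr_suml.
  rewrite exchange_big /=; apply: eq_bigr => g _; rewrite mulr_sumr.
  by apply: eq_bigr => t _; rewrite mulrA.
(* By uniqueness of the D_k-coefficients, the coordinates of [c g] are a D_k-combination of the rows
   of Q, which are relations in M. *)
move=> g gR; have [_ [-> // _]] := dP g.
transitivity (\sum_j \sum_t act (wc t g * Q (delta_mx 0 t) 0 j) (u j)).
  apply: eq_bigr => j _; rewrite -act_suml; congr (act _ _).
  apply/eqP; rewrite -subr_eq0; apply/eqP.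
  apply: (ddivm_centr_free (r := mnms N)
    (c := fun g => d g j - \sum_t wc t g * Q (delta_mx 0 t) 0 j) q0 qP).
  - exact: mnms_uniq.
  - move=> h _; apply: (@subspaceB _ _ (@centr K n q)); first exact: centr_subspace.
      by have [dC _] := dP h; exact: dC.
    apply: subspace_sum => [|t _]; first exact: centr_subspace.
    by apply: centrM => //; exact: (Rk (t, j)).
  - by under eq_bigr do rewrite mulrBr; rewrite sumrB eE subrr.
  - by rewrite mem_mnms leq_max (leq_bigmax_seq (F := mdeg) (P := predT) _ gR isT) orbT.
rewrite exchange_big big1 //= => t _.
transitivity (act (wc t g) (\sum_j act (Q (delta_mx 0 t) 0 j) (u j))).
  by rewrite act_sumr; apply: eq_bigr => j _; rewrite actM.
by rewrite rel act0r.
Qed.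
End Free.

Lemma free_on_sub (K : fieldType) (V : lmodType K) (T : eqType) (s t : seq T) (v : T -> V) :
  uniq s -> uniq t -> {subset s <= t} -> free_on t v -> free_on s v.
Proof.
move=> us ut st tf c c0 x xs.
have := tf (fun y => if y \in s then c y else 0) _ x (st x xs); rewrite xs; apply.
rewrite -[RHS]c0 (bigID (mem s)) /= [X in _ + X]big1 ?addr0 => [|y /negbTE ->]; last first.
  by rewrite scale0r.
rewrite -big_filter big_seq.
rewrite (perm_big s) /=; last first.
  apply: uniq_perm => //; first by rewrite filter_uniq.
  by move=> y; rewrite mem_filter; case: (boolP (y \in s)) => //= /st ->.
under eq_bigl do rewrite mem_filter.
rewrite [RHS]big_seq; apply: eq_big => y; last by move=> /andP[-> _].
by case: (boolP (y \in s)) => //= /st ->.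
Qed.

(** * Standard bases of filtered modules, Hilbert functions and Artin-Rees *)

Section Hilbert.
Import mpoly.
Variables (K : fieldType) (n : nat).
Local Notation D := (diffop (polyalg K n)).
Local Notation F i := (kspan (@dmono_le K n i)).
Variables (q : nat) (q0 : (0 < q)%N) (qP : pascal_step K q) (r : nat).

(* The index (a, ((b, c), j)) of type T stands for x^(q a) d^[b] x^c s_j. *)
Local Notation J := ({ffun 'I_n -> 'I_q} * {ffun 'I_n -> 'I_q} * 'I_r)%type.
Local Notation T := ('X_{1..n} * J)%type.
Implicit Types (x y z : T) (a g d : 'X_{1..n}) (e : J).

Definition mnm_ffun (f : {ffun 'I_n -> 'I_q}) : 'X_{1..n} := [multinom (f i : nat) | i < n].

Lemma mnm_ffun_surj a : (forall i, (a i < q)%N) -> exists f, mnm_ffun f = a.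
Proof.
move=> aq; exists [ffun i => Ordinal (aq i)].
by apply/mnmP => i; rewrite mnmE ffunE.
Qed.

Definition jdeg e : nat := (mdeg (mnm_ffun e.1.1) + mdeg (mnm_ffun e.1.2))%N.
Definition tdeg x : nat := (mdeg x.1 * q + jdeg x.2)%N.

(** Degree is compared first, so that reductions never leave a step of the filtration; ties are
    broken by a monomial order on a and an enumeration of J, which makes the order total and
    invariant under shifts. *)
Definition tlt x y := (tdeg x < tdeg y)%N || ((tdeg x == tdeg y) &&
  ((x.1 < y.1)%O || ((x.1 == y.1) && (enum_rank x.2 < enum_rank y.2)%N))).

Lemma tlt_irr : irreflexive tlt.
Proof. by move=> x; rewrite /tlt !ltnn ltxx !andbF. Qed.

Lemma tlt_trans : transitive tlt.
Proof.
move=> y x z; rewrite /tlt => /orP[xy|/andP[/eqP-> xy]] /orP[yz|/andP[/eqP E yz]].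
- by rewrite (ltn_trans xy yz).
- by rewrite -E xy.
- by rewrite yz.
- rewrite E eqxx ltnn /=; move: xy yz => /orP[xy|/andP[/eqP-> xy]] /orP[yz|/andP[/eqP<- yz]].
  + by rewrite (lt_trans xy yz).
  + by rewrite xy.
  + by rewrite yz.
  + by rewrite eqxx (ltn_trans xy yz) orbT.
Qed.

Lemma tlt_total x y : x != y -> tlt x y || tlt y x.
Proof.
move=> xy; rewrite /tlt; case: (ltngtP (tdeg x) (tdeg y)) => //= _.
case: (ltgtP x.1 y.1) => //= xy1.
case: (ltngtP (enum_rank x.2) (enum_rank y.2)) => //= /val_inj /enum_rank_inj xy2.
by move: xy; rewrite [x]surjective_pairing [y]surjective_pairing xy1 xy2 eqxx.
Qed.

Lemma tlt_deg x y : tlt x y -> (tdeg x <= tdeg y)%N.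
Proof. by move=> /orP[/ltnW|/andP[/eqP-> _]]. Qed.

Definition tshift d x : T := ((x.1 + d)%MM, x.2).

Lemma tdeg_shift d x : tdeg (tshift d x) = (mdeg d * q + tdeg x)%N.
Proof. by rewrite /tdeg /= mdegD; lia. Qed.

Lemma tlt_shift d x y : tlt x y -> tlt (tshift d x) (tshift d y).
Proof.
by rewrite /tlt !tdeg_shift ltn_add2l eqn_add2l /= ltmc_add2l eqm_add2r.
Qed.

Definition tbelow x : seq T :=
  [seq y <- [seq (a, e) | a <- mnms n (tdeg x), e <- enum {: J}] | (tdeg y <= tdeg x)%N].

Lemma mem_tbelow x y : (y \in tbelow x) = (tdeg y <= tdeg x)%N.
Proof.
rewrite mem_filter; case: (boolP (tdeg y <= _)%N) => //= yx.
case: y yx => a e yx; apply/allpairsP; exists (a, e); split=> //=; last by rewrite mem_enum.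
rewrite mem_mnms; apply: leq_trans yx; rewrite /tdeg /= (leq_trans _ (leq_addr _ _)) //.
by rewrite leq_pmulr.
Qed.

Lemma tlt_below x y : tlt y x -> y \in tbelow x.
Proof. by rewrite mem_tbelow; exact: tlt_deg. Qed.

Lemma tlt_sub_below x y : tlt y x -> {subset tbelow y <= tbelow x}.
Proof. by move=> /tlt_deg yx z; rewrite !mem_tbelow => /leq_trans; apply. Qed.

Section Family.
Variables (M : lmodType D) (s : 'I_r -> kres M).

(** Three layers: [bvec] gives finitely many vectors, [tvec] their multiples by monomials in the
    x_i^q, inside M', and [wvec] the translates by d^[q g], inside M. *)
Definition bvec e : kres M :=
  act (ddivm K (mnm_ffun e.1.1) * xmon K (mnm_ffun e.1.2)) (s e.2).
Definition tvec x : kres M := act (xmon K (x.1 *+ q)%MM) (bvec x.2).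
Definition wvec (gx : 'X_{1..n} * T) : kres M := act (ddivm K (gx.1 *+ q)%MM) (tvec gx.2).

Definition tstd x := std tlt tvec x.

Lemma tvec_shift d x : tvec (tshift d x) = act (xmon K (d *+ q)%MM) (tvec x).
Proof.
rewrite /tvec /= -actM -xmonD; congr (act (xmon K _) _).
by apply/mnmP => i; rewrite !(mulmnE, mnmDE) mulnDl addnC.
Qed.

Lemma tstd_shift d x : tstd (tshift d x) -> tstd x.
Proof.
apply: contra_not; rewrite tvec_shift => tx.
have : (act (xmon K (d *+ q)%MM) @` kspan (tvec @` [set y | tlt y x]))
    (act (xmon K (d *+ q)%MM) (tvec x)) by exists (tvec x).
rewrite image_kspan; last exact: act_linear.
apply: kspanS => _ [_ [y yx <-] <-]; exists (tshift d y); last exact: tvec_shift.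
exact: tlt_shift.
Qed.

Lemma tvec_centr x : centr_span s q (tvec x).
Proof.
exists (fun j => if j == x.2.2 then xmon K (x.1 *+ q)%MM *
  (ddivm K (mnm_ffun x.2.1.1) * xmon K (mnm_ffun x.2.1.2)) else 0); split.
  move=> j; case: eqP => _; last by case: (centr_subspace K n q).
  apply: centrM; first exact: centr_xmon.
  apply: centrM; last exact: centr_xmon.
  by apply: centr_ddivm => // l; rewrite mnmE ltn_ord.
rewrite (bigD1 x.2.2) //= eqxx big1 ?addr0; first by rewrite actM.
by move=> j /negbTE ->; rewrite act0l.
Qed.

Lemma centr_span_subspace : subspace (centr_span s q).
Proof.
split.
  exists (fun=> 0); split=> [j|]; first by case: (centr_subspace K n q).
  by rewrite big1 // => j _; rewrite act0l.
move=> c _ _ [d1 [d1C ->]] [d2 [d2C ->]]; exists (fun j => c *: d1 j + d2 j); split.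
  by move=> j; apply centr_subspace.
rewrite scaler_sumr -big_split; apply: eq_bigr => j _ /=.
by rewrite actDl actZl.
Qed.

Lemma wvec_F g x : exists2 u, F (mdeg g * q + tdeg x)%N u & wvec (g, x) = act u (s x.2.2).
Proof.
exists (ddivm K (g *+ q)%MM * (xmon K (x.1 *+ q)%MM *
  (ddivm K (mnm_ffun x.2.1.1) * xmon K (mnm_ffun x.2.1.2)))); last by rewrite /wvec /tvec /bvec /= !actM.
have Fx a : F (mdeg a) (xmon K a).
  by have := @F_op K n a 0%MM; rewrite ddivm0 mul1r mdeg0.
have Fd a : F (mdeg a) (ddivm K a).
  by have := @F_op K n 0%MM a; rewrite xmon0 mulr1 mdeg0 addn0.
apply: F_mul; first by rewrite -mdegMn.
apply: F_mul; first by rewrite -mdegMn.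
exact: F_mul.
Qed.

(** Division with remainder respects degrees, since |a| = q |a div q| + |a mod q|; so
    [ddivm_xmon_split] splits each step of the filtration. *)
Lemma F_family i : mspan (F i) (range s) =
  kspan (wvec @` [set gx | (mdeg gx.1 * q + tdeg gx.2 <= i)%N]).
Proof.
apply/seteqP; split.
  apply: mspan_min => // u _ /F_sub_op Fu [j _ <-]; move: u Fu.
  suff : kspan (dmono_op i) `<=`
    [set u | kspan (wvec @` [set gx | (mdeg gx.1 * q + tdeg gx.2 <= i)%N]) (act u (s j))] by [].
  apply: kspan_min.
    split; first rewrite /= act0l.
      by case: (kspan_subspace (wvec @` [set gx | (mdeg gx.1 * q + tdeg gx.2 <= i)%N])).
    by move=> c u v /= Wu Wv; rewrite actDl actZl; apply kspan_subspace.
  move=> _ [a [b [ab ->]]] /=; rewrite (ddivm_xmon_split a b q0 qP); apply: sub_kspan.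
  have [|fb fbE] := @mnm_ffun_surj (mmodq q b); first by move=> l; exact: mmodq_lt.
  have [|fa faE] := @mnm_ffun_surj (mmodq q a); first by move=> l; exact: mmodq_lt.
  exists (mdivq q b, (mdivq q a, (fb, fa, j))).
    rewrite /= /tdeg /= /jdeg /= fbE faE; move: ab.
    by rewrite [in mdeg a](mdeg_divq q a) [in mdeg b](mdeg_divq q b); lia.
  by rewrite /wvec /tvec /bvec /= fbE faE !actM.
apply: kspan_min; first exact: mspan_subspace.
move=> _ [[g x] gx <-]; have [u Fu ->] := wvec_F g x.
by apply: mspan_act; [exact: F_leq Fu | exists x.2.2].
Qed.

(* l concatenates the exponents g of d^[q g] and a of x^(q a). *)
Definition nonstd e : pred (seq nat) := fun l => ~~ `[< tstd (mnm_seq n (drop n l), e) >].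

(** Grouping by e turns the degree condition on (g, a) into |g| + |a| <= (i - jdeg e) div q, a count
    of exponents in 2n variables. *)
Definition bidx i : seq ('X_{1..n} * T) :=
  [seq (mnm_seq n (take n l), (mnm_seq n (drop n l), e)) |
    e <- [seq e <- enum {: J} | (jdeg e <= i)%N],
    l <- [seq l <- mons (n + n) ((i - jdeg e) %/ q) | ~~ nonstd e l]].

Lemma mem_bidx i g x : ((g, x) \in bidx i) =
  `[< tstd x >] && (mdeg g * q + tdeg x <= i)%N.
Proof.
case: x => a e; apply/allpairsPdep/andP.
  move=> [e' [l]]; rewrite !mem_filter mem_mons /nonstd negbK.
  move=> [/andP[ei _] /and3P[ls /eqP sl li] [-> -> ->]]; split=> //.
  rewrite /tdeg /= !mdeg_sumn !seq_mnmK; last first.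
  - by rewrite size_takel // sl leq_addr.
  - by rewrite size_drop sl addKn.
  rewrite addnA -mulnDl -sumn_cat cat_take_drop.
  by rewrite leq_divRL // in li; lia.
move=> [ls]; rewrite /tdeg /= => gai.
have eJ : e \in enum {: J} by rewrite mem_enum.
have sg : size g = n by rewrite size_tuple.
have tg : take n (g ++ a) = g by rewrite -{1}sg take_size_cat.
have dg : drop n (g ++ a) = a by rewrite -{1}sg drop_size_cat.
exists e, (g ++ a : seq nat); split; last by rewrite tg dg !mnm_seqK.
  by rewrite mem_filter; apply/andP; split; [lia | exact: eJ].
rewrite mem_filter mem_mons /nonstd negbK dg mnm_seqK ls size_cat !size_tuple eqxx.
by rewrite sumn_cat -!mdeg_sumn /= leq_divRL //; lia.
Qed.

Lemma bidx_uniq i : uniq (bidx i).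
Proof.
apply: allpairs_uniq_dep; first by rewrite filter_uniq ?enum_uniq.
  by move=> e _; rewrite filter_uniq ?mons_uniq.
move=> _ _ /allpairsPdep[e [l [_ + ->]]] /allpairsPdep[e' [l' [_ + ->]]] /=.
rewrite !mem_filter !mem_mons => /and3P[_ /eqP sl _] /and3P[_ /eqP sl' _].
move=> E; have E1 := congr1 fst E; have E2 := congr1 (fun y : 'X_{1..n} * T => y.2.1) E.
have /= -> := congr1 (fun y : 'X_{1..n} * T => y.2.2) E; congr (Tagged _ _).
rewrite -(cat_take_drop n l) -(cat_take_drop n l').
have st (t : seq nat) : size t = (n + n)%N -> size (take n t) = n.
  by move=> tE; rewrite size_takel // tE leq_addr.
have sd (t : seq nat) : size t = (n + n)%N -> size (drop n t) = n.
  by move=> tE; rewrite size_drop tE addKn.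
rewrite -(seq_mnmK (st l sl)) -(seq_mnmK (sd l sl)) -(seq_mnmK (st l' sl')) -(seq_mnmK (sd l' sl')).
congr (_ ++ _); [move: E1 | move: E2] => /=;
  exact: (congr1 (fun m : 'X_{1..n} => m : seq nat)).
Qed.

(** Two layers: [ddiv_free] separates a relation into one relation for each g, and [std_free]
    disposes of each of these. *)
Lemma bidx_free i : ddiv_free q (centr_span s q) -> free_on (bidx i) wvec.
Proof.
move=> sf; pose tl := [seq x <- [seq (a, e) | a <- mnms n i, e <- enum {: J}] | `[< tstd x >]].
have utl : uniq tl.
  rewrite filter_uniq // allpairs_uniq ?mnms_uniq ?enum_uniq //.
  by move=> [? ?] [? ?] _ _ [-> ->].
(* A full product containing [bidx i], so that the double sum can be grouped by g. *)
pose big := [seq (g, x) | g <- mnms n i, x <- tl].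
have ubig : uniq big.
  rewrite allpairs_uniq ?mnms_uniq //.
  by move=> [? ?] [? ?] _ _ [-> ->].
apply: (free_on_sub (bidx_uniq i) ubig).
  move=> [g x]; rewrite mem_bidx => /andP[xs gxi]; apply: allpairs_f.
    by rewrite mem_mnms; nia.
  rewrite mem_filter xs /=; case: x gxi {xs} => a e gxi; apply: allpairs_f; rewrite ?mem_enum //.
  by rewrite mem_mnms; move: gxi; rewrite /tdeg /=; nia.
move=> c; rewrite big_allpairs => c0 _ /allpairsP[[g x] [gi xt ->]] /=.
have ts : forall x, x \in tl -> tstd x by move=> y; rewrite mem_filter => /andP[/asboolP].
apply: (std_free tlt_trans tlt_total utl ts (c := fun x => c (g, x))) => //.
apply: (sf (mnms n i) (fun g => \sum_(x <- tl) c (g, x) *: tvec x)) => //.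
- exact: mnms_uniq.
- move=> h _; apply: subspace_sum => [|y _]; first exact: centr_span_subspace.
  by apply: subspaceZ; [exact: centr_span_subspace | exact: tvec_centr].
- rewrite -[RHS]c0; apply: eq_bigr => h _; rewrite act_sumr.
  by apply: eq_bigr => y _; rewrite actZr.
Qed.

Lemma bidx_span i : mspan (F i) (range s) = kspan (wvec @` [set` bidx i]).
Proof.
rewrite F_family; apply/seteqP; split; apply: kspan_min => //.
  move=> _ [[g x] /= gxi <-].
  have := std_span tlt_irr tlt_trans tlt_below tlt_sub_below tvec x => xs.
  have : (act (ddivm K (g *+ q)%MM) @` kspan (tvec @` [set y | tstd y /\ (y = x \/ tlt y x)]))
      (wvec (g, x)) by exists (tvec x).
  rewrite image_kspan; last exact: act_linear.
  apply: kspanS => _ [_ [y [ys yx] <-] <-]; exists (g, y) => //.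
  have : (g, y) \in bidx i; last by [].
  rewrite mem_bidx; apply/andP; split; first exact/asboolP.
  apply: leq_trans gxi; rewrite leq_add2l.
  by case: yx => [->//|]; exact: tlt_deg.
move=> _ [[g x] gx <-]; have : (g, x) \in bidx i by [].
rewrite mem_bidx => /andP[_ gxi].
by apply: sub_kspan; exists (g, x).
Qed.

Lemma nonstd_upset e : upset (n + n) (nonstd e).
Proof.
move=> a b sa ab; apply: contra => /asboolP bs; apply/asboolP.
pose d := (mnm_seq n (drop n b) - mnm_seq n (drop n a))%MM.
apply: (@tstd_shift d).
rewrite /tshift /= (_ : _ + d = mnm_seq n (drop n b))%MM //.
rewrite addmC submK //; apply/mnm_lepP => i; rewrite !mnmE !nth_drop.
exact: lle_nth.
Qed.

Lemma hilbert_function : (0 < n)%N -> ddiv_free q (centr_span s q) ->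
  exists L : seq (nat * nat), (forall c, c \in L -> (0 < c.2)%N) /\
  forall i, has_kdim (mspan (F i) (range s))
    (\sum_(c <- L) (c.1 <= i) * 'C((i - c.1) %/ q + c.2, c.2)).
Proof.
move=> n0 sf.
have nE : (n + n)%N = (n + n).-1.+1 by rewrite prednK // addn_gt0 n0.
have /choice[l /all_and2[l0 lE]] e : exists l, (forall c, c \in l -> (0 < c.2)%N) /\
    forall m, count (predC (nonstd e)) (mons (n + n) m) = hval l m.
  (* Standardness ignores the exponents g, which come first, and n > 0 provides at least one of
     them; this makes every binomial of positive degree. *)
  rewrite nE; apply: count_mons_cylinder; first by rewrite -nE; exact: nonstd_upset.
  move=> t a; rewrite /nonstd; suff -> : drop n (t :: a) = drop n (0%N :: a) by [].
  by rewrite -(prednK n0).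
exists (flatten [seq [seq (c.1 * q + jdeg e, c.2)%N | c <- l e] | e <- enum {: J}]); split.
  by move=> _ /flattenP[_ /mapP[e _ ->] /mapP[y yl ->]]; exact: l0 yl.
move=> i; rewrite bidx_span.
have -> : (\sum_(c <- flatten [seq [seq (c.1 * q + jdeg e, c.2)%N | c <- l e] | e <- enum {: J}])
    (c.1 <= i) * 'C((i - c.1) %/ q + c.2, c.2))%N = size (bidx i).
  rewrite size_allpairs_dep sumnE big_map big_filter big_flatten big_map /= [RHS]big_mkcond.
  apply: eq_bigr => e _; rewrite size_filter big_map /=.
  case: leqP => ei; last first.
    by rewrite big1 // => c _; rewrite leqNgt (leq_trans ei) ?leq_addl.
  rewrite (lE e) /hval; apply: eq_bigr => c _; rewrite leq_divRL //=.
  rewrite (_ : (c.1 * q <= i - jdeg e) = (c.1 * q + jdeg e <= i))%N; last by lia.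
  by congr (_ * 'C(_ + _, _))%N; rewrite addnC subnDA divnBMl.
by apply: has_kdim_seq; [exact: bidx_uniq | exact: bidx_free].
Qed.

End Family.

Lemma tvec_map (M L : lmodType D) (g : {linear M -> L}) (s : 'I_r -> kres M) x :
  tvec (kmap g \o s) x = kmap g (tvec s x).
Proof. by rewrite /tvec /bvec /= !kmap_act. Qed.

Lemma wvec_map (M L : lmodType D) (g : {linear M -> L}) (s : 'I_r -> kres M) gx :
  wvec (kmap g \o s) gx = kmap g (wvec s gx).
Proof. by rewrite /wvec tvec_map kmap_act. Qed.

(* Artin-Rees: S is obtained by reducing the minimal non-standard monomials of
   the image family. *)
Lemma kernel_filtration (M L : lmodType D) (g : {linear M -> L}) (s : 'I_r -> kres M) :
  ddiv_free q (centr_span (kmap g \o s) q) ->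
  exists S : seq (kres M), (forall m, m \in S -> kmap g m = 0) /\
  forall i m, mspan (F i) (range s) m -> kmap g m = 0 -> mspan (F i) [set` S] m.
Proof.
move=> gf; set s' := kmap g \o s in gf *.
have /choice[Bl BlP] e : exists B : seq (seq nat),
    (forall b, b \in B -> size b = n /\ ~ tstd s' (mnm_seq n b, e)) /\
    forall l, size l = n -> ~ tstd s' (mnm_seq n l, e) -> exists2 b, b \in B & lle b l.
  have [|B [B1 B2]] := @upset_basis n (fun l => ~~ `[< tstd s' (mnm_seq n l, e) >]).
    move=> a b sa ab; apply: contra => /asboolP bs; apply/asboolP.
    apply: (@tstd_shift _ s' (mnm_seq n b - mnm_seq n a)%MM).
    rewrite /tshift /= (_ : _ + _ = mnm_seq n b)%MM // addmC submK //.
    by apply/mnm_lepP => i; rewrite !mnmE; exact: lle_nth.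
  exists B; split; first by move=> b /B1[? /asboolP].
  by move=> a sa aN; apply: B2 => //; apply/negP => /asboolP.
pose B := [seq (mnm_seq n b, e) | e <- enum {: J}, b <- Bl e].
have BN y : y \in B -> ~ tstd s' y.
  by move=> /allpairsPdep[e [b [_ bB ->]]]; have [/(_ b bB)[]] := BlP e.
have BP x : ~ tstd s' x -> exists y d, y \in B /\ x = tshift d y.
  case: x => a e xN; have [_ /(_ a)] := BlP e.
  rewrite size_tuple mnm_seqK => /(_ erefl xN)[b bB ba].
  exists (mnm_seq n b, e), (a - mnm_seq n b)%MM; split.
    by apply: allpairs_f_dep => //; rewrite mem_enum.
  rewrite /tshift /= addmC submK //; apply/mnm_lepP => i.
  by rewrite mnmE (mnm_nth 0%N); exact: lle_nth.
(* For non-standard y the image vector is a combination of images of smaller vectors; t y is the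
   same combination taken in M, so [tvec s y - t y] lies in the kernel. *)
have /choice[t tP] y : exists t, y \in B ->
    kspan (tvec s @` [set z | tlt z y]) t /\ kmap g (tvec s y - t) = 0.
  case: (boolP (y \in B)) => [yB|_]; last by exists 0.
  have := contrapT (BN y yB); rewrite tvec_map.
  have -> : tvec s' @` [set z | tlt z y] = kmap g @` (tvec s @` [set z | tlt z y]).
    by rewrite image_comp; apply: eq_imagel => z _; exact: tvec_map.
  rewrite -image_kspan; last exact: kmap_linear.
  move=> [t tk tE]; exists t => _; split=> //.
  by rewrite (linmapB (kmap_linear g)) tE subrr.
pose S := [seq tvec s y - t y | y <- B]; exists S; split.
  by move=> _ /mapP[y yB ->]; have [] := tP y yB.
pose W i := (tvec s @` [set y | tstd s' y /\ (tdeg y <= i)%N]) `|`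
  [set act u m | u in F i & m in [set` S]].
have WS i j : (i <= j)%N -> W i `<=` W j.
  move=> ij m [[y [ys yi] <-]|[u Fu [z Sz <-]]].
    by left; exists y => //; split=> //; exact: leq_trans ij.
  by right; exists u; [exact: F_leq Fu | exists z].
(* Division by the kernel elements: a non-standard x is a shift of some y in B by d; x^(q d)
   ([tvec s y - t y]) lies in F S within the degree of x, and x^(q d) t y involves only indices
   below x. *)
have tW x : kspan (W (tdeg x)) (tvec s x).
  elim/(lt_ind tlt_irr tlt_trans tlt_below tlt_sub_below): x => x IH.
  have [xs|/BP[y [d [yB xE]]]] := pselect (tstd s' x).
    by apply: sub_kspan; left; exists x.
  have [tk _] := tP y yB.
  rewrite xE tvec_shift -[tvec s y](subrK (t y)) (linmapD (act_linear _)).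
  apply: subspaceD => //.
    apply: sub_kspan; right; exists (xmon K (d *+ q)%MM).
      rewrite tdeg_shift -mdegMn; apply: (@F_leq _ _ (mdeg (d *+ q)%MM)); first exact: leq_addr.
      by have := @F_op K n (d *+ q)%MM 0%MM; rewrite ddivm0 mul1r mdeg0.
    by exists (tvec s y - t y) => //; exact: map_f.
  have : (act (xmon K (d *+ q)%MM) @` kspan (tvec s @` [set z | tlt z y]))
    (act (xmon K (d *+ q)%MM) (t y)) by exists (t y).
  rewrite image_kspan; last exact: act_linear.
  apply: kspan_min => // _ [_ [z zy <-] <-]; rewrite -tvec_shift.
  have zx : tlt (tshift d z) x by rewrite xE; exact: tlt_shift.
  by rewrite -xE; move: (IH _ zx); apply: kspanS; apply: WS; exact: tlt_deg.
pose W' i := (wvec s @` [set gx | tstd s' gx.2 /\ (mdeg gx.1 * q + tdeg gx.2 <= i)%N]) `|`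
  [set act u m | u in F i & m in [set` S]].
move=> i m; rewrite F_family => mw gm.
have {mw} : kspan (W' i) m.
  move: m mw {gm}; apply: kspan_min => // _ [[h x] /= hxi <-].
  have : (act (ddivm K (h *+ q)%MM) @` kspan (W (tdeg x))) (wvec s (h, x)) by exists (tvec s x).
  rewrite image_kspan; last exact: act_linear.
  apply: kspanS => _ [_ [[y [ys yx] <-]|[u Fu [z Sz <-]]] <-].
    by left; exists (h, y) => //; split=> //=; apply: leq_trans hxi; rewrite leq_add2l.
  right; exists (ddivm K (h *+ q)%MM * u); last by exists z => //; exact: actM.
  apply: F_leq hxi _ _; apply: F_mul => //.
  by rewrite -mdegMn; have := @F_op K n 0%MM (h *+ q)%MM; rewrite xmon0 mulr1 mdeg0 addn0.
move=> /kspanU[a [b [aW bW mE]]].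
(* Since m and b lie in the kernel, so does a; but a is a combination of vectors at standard indices
   of the image family, whose images are independent. *)
suff a0 : a = 0 by rewrite mE a0 add0r.
have gb : kmap g b = 0.
  have : (kmap g @` kspan [set act u m | u in F i & m in [set` S]]) (kmap g b) by exists b.
  rewrite image_kspan; last exact: kmap_linear.
  suff : kspan (kmap g @` [set act u m | u in F i & m in [set` S]]) `<=` [set 0%R].
    by move=> k0 /k0.
  apply: kspan_min.
    by split=> // c u v -> ->; rewrite scaler0 addr0.
  move=> _ [_ [u _ [z /mapP[y yB ->] <-]] <-].
  by rewrite kmap_act; have [_ ->] := tP y yB; rewrite act0r.
have : kspan (wvec s @` [set` bidx s' i]) a.
  move: aW; apply: kspanS => _ [[h x] [xs hxi] <-]; exists (h, x) => //.
  have : (h, x) \in bidx s' i; last by [].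
  by rewrite mem_bidx hxi andbT; apply/asboolP.
move=> /kspan_seqP; case; first exact: bidx_uniq.
move=> c aE; rewrite aE big_seq big1 // => hx hxB.
suff -> : c hx = 0 by rewrite scale0r.
apply: (bidx_free gf _ hxB).
have ga : kmap g a = 0.
  have := gm; rewrite mE (linmapD (kmap_linear g)) gb addr0 //.
rewrite -[RHS]ga aE (linmap_sum (kmap_linear g)).
by apply: eq_bigr => hy _; rewrite wvec_map -(linmapZ (kmap_linear g)).
Qed.

End Hilbert.

From mathcomp Require Import all_classical all_reals all_analysis.
From mathcomp Require Import ring.
Import numFieldNormedType.Exports.
Local Open Scope classical_set_scope.
Local Open Scope ring_scope.

(** * Growth of Hilbert functions *)

Section Asymptotics.
Variable R : realType.
Implicit Types (h : nat -> nat) (d : nat) (c : R).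

Definition asym h d c := (fun i => (h i)%:R / i%:R ^+ d : R) @ \oo --> c.

Lemma cvg_exprn (u : nat -> R) (l : R) d : u @ \oo --> l ->
  (fun i => u i ^+ d) @ \oo --> l ^+ d.
Proof.
move=> ul; elim: d => [|d IH]; first by rewrite expr0; under eq_fun do rewrite expr0; exact: cvg_cst.
by rewrite exprS; under eq_fun do rewrite exprS; exact: cvgM.
Qed.

Lemma cvg_invn : (fun i : nat => (i%:R : R)^-1) @ \oo --> (0 : R).
Proof.
apply/gtr0_cvgV0; last exact: cvgr_idn.
by near=> i; rewrite ltr0n; near: i; exact: nbhs_infty_gt.
Unshelve. all: by end_near. Qed.

Lemma cvg_shift (u : nat -> R) (l : R) N :
  (fun i => u (i + N)%N) @ \oo --> l <-> u @ \oo --> l.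
Proof. by rewrite (cvg_shiftn N u (nbhs l)). Qed.

Lemma cvg_bounded_divn (e : nat -> nat) N : (forall i, e i <= N)%N ->
  (fun i => (e i)%:R / (i%:R : R)) @ \oo --> (0 : R).
Proof.
move=> eN; apply: (@squeeze_cvgr _ _ _ _ (fun=> 0) (fun i => N%:R * (i%:R : R)^-1)).
- near=> i; apply/andP; split; first by rewrite divr_ge0.
  by rewrite ler_wpM2r ?invr_ge0 // ler_nat.
- exact: cvg_cst.
- by rewrite -[X in _ --> X](mulr0 (N%:R : R)); apply: cvgM; [exact: cvg_cst | exact: cvg_invn].
Unshelve. all: by end_near. Qed.

Lemma cvg_ratio a b : (fun i => (i + a)%:R / ((i + b)%:R : R)) @ \oo --> (1 : R).
Proof.
have : (fun i => 1 + (a%:R - b%:R) * ((i + b)%:R : R)^-1) @ \oo --> 1 + (a%:R - b%:R) * (0 : R).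
  apply: cvgD; first exact: cvg_cst.
  apply: cvgM; first exact: cvg_cst.
  by apply/(cvg_shift (fun i => (i%:R : R)^-1)); exact: cvg_invn.
rewrite mulr0 addr0; apply: cvg_trans; apply: near_eq_cvg; near=> i.
have ib : (i + b)%:R != 0 :> R.
  by rewrite pnatr_eq0 -lt0n addn_gt0; apply/orP; left; near: i; exact: nbhs_infty_gt.
by rewrite !natrD in ib *; field.
Unshelve. all: by end_near. Qed.

Lemma asym_lt h d d' c : (d < d')%N -> asym h d c -> asym h d' 0.
Proof.
move=> dd' hc.
have : (fun i => (h i)%:R / i%:R ^+ d * ((i%:R : R)^-1) ^+ (d' - d)) @ \oo --> c * 0 ^+ (d' - d).
  by apply: cvgM => //; apply: cvg_exprn; exact: cvg_invn.
rewrite expr0n subn_eq0 leqNgt dd' mulr0; apply: cvg_trans; apply: near_eq_cvg; near=> i.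
by rewrite -mulrA -exprVn -exprD subnKC ?exprVn // ltnW.
Unshelve. all: by end_near. Qed.

Lemma asym_add h h' d c c' : asym h d c -> asym h' d c' ->
  asym (fun i => h i + h' i)%N d (c + c').
Proof.
move=> hc hc'; rewrite /asym; under eq_fun do rewrite natrD mulrDl.
exact: cvgD.
Qed.

Lemma asym0 d : asym (fun=> 0%N) d 0.
Proof. by rewrite /asym; under eq_fun do rewrite mul0r; exact: cvg_cst. Qed.

(** A bounded shift of the argument multiplies i^d by a factor tending to 1. This is how the leading
    term becomes independent of the generating space. *)
Lemma asym_squeeze h h' d c a b : asym h d c ->
  (forall i, h' i <= h (i + a))%N -> (forall i, h i <= h' (i + b))%N -> asym h' d c.
Proof.
move=> hc ha hb; apply/(cvg_shift _ _ b).
apply: (@squeeze_cvgr _ _ _ _ (fun i => (h i)%:R / i%:R ^+ d * (i%:R / (i + b)%:R) ^+ d)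
  (fun i => (h (i + (b + a))%N)%:R / (i + (b + a))%:R ^+ d *
     ((i + (b + a))%:R / (i + b)%:R) ^+ d)).
- near=> i.
  have i0 (N : nat) : (i + N)%:R ^+ d != 0 :> R.
    rewrite expf_neq0 // pnatr_eq0 -lt0n addn_gt0; apply/orP; left.
    by near: i; exact: nbhs_infty_gt.
  have := i0 0%N; rewrite addn0 => i00.
  rewrite !expr_div_n !mulrA !divfK //.
  by rewrite !ler_wpM2r ?invr_ge0 ?exprn_ge0 // ler_nat // addnA.
- rewrite -[c]mulr1 -[X in _ * X](expr1n _ d); apply: cvgM => //; apply: cvg_exprn.
  by have := cvg_ratio 0 b; under eq_fun do rewrite addn0.
- rewrite -[c]mulr1 -[X in _ * X](expr1n _ d); apply: cvgM.
    by apply/(cvg_shift (fun i => (h i)%:R / i%:R ^+ d : R)).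
  by apply: cvg_exprn; exact: cvg_ratio.
Unshelve. all: by end_near. Qed.

(** The integer quotient (i - a) div q is i/q up to a bounded error, and C(x + d, d) grows like x^d
    / d!. *)
Lemma asym_binomial q a d : (0 < q)%N ->
  asym (fun i => (a <= i) * 'C((i - a) %/ q + d, d))%N d ((q%:R ^+ d)^-1 / d`!%:R).
Proof.
move=> q0; pose x i := ((i - a) %/ q)%N.
have q0R : q%:R != 0 :> R by rewrite pnatr_eq0 -lt0n.
have xq : (fun i => (x i)%:R / (i%:R : R)) @ \oo --> (q%:R^-1 : R).
  (* The [minn] makes boundedness immediate; for i >= a it is the numerator itself, which equals a
     plus a remainder modulo q. *)
  have : (fun i => q%:R^-1 - q%:R^-1 * ((minn (i - x i * q) (a + q))%:R / i%:R) : R) @ \oo -->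
      (q%:R^-1 - q%:R^-1 * 0 : R).
    apply: cvgB; first exact: cvg_cst.
    apply: cvgM; first exact: cvg_cst.
    by apply: (@cvg_bounded_divn _ (a + q)) => i; rewrite geq_minr.
  rewrite mulr0 subr0; apply: cvg_trans; apply: near_eq_cvg; near=> i.
  have ai : (a <= i)%N by near: i; exact: nbhs_infty_ge.
  have i0 : i%:R != 0 :> R.
    by rewrite pnatr_eq0 -lt0n; near: i; exact: nbhs_infty_gt.
  have xi : (x i * q <= i)%N.
    by rewrite /x (leq_trans (leq_trunc_div _ _)) // leq_subr.
  have le_e : (i - x i * q <= a + q)%N.
    have := divn_eq (i - a) q; have := ltn_pmod (i - a) q0; rewrite -/(x i).
    move: xi; lia.
  rewrite (minn_idPl le_e) natrB // natrM.
  by field; rewrite i0 q0R.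
have key : asym (fun i => 'C(x i + d, d)) d ((q%:R ^+ d)^-1 / d`!%:R).
  elim: d => [|d IH].
    rewrite /asym (_ : _ / 0`!%:R = 1); last by rewrite fact0 expr0 divr1 invr1.
    by under eq_fun do rewrite bin0 expr0 divr1; exact: cvg_cst.
  have x1 : (fun i => ((x i)%:R / i%:R + d.+1%:R / i%:R) / (d.+1%:R : R)) @ \oo -->
      ((q%:R^-1 + 0) / d.+1%:R : R).
    apply: cvgM; last exact: cvg_cst.
    by apply: cvgD => //; apply: (@cvg_bounded_divn (fun=> d.+1) d.+1).
  have -> : (q%:R ^+ d.+1)^-1 / (d.+1)`!%:R =
      (q%:R ^+ d)^-1 / d`!%:R * ((q%:R^-1 + 0) / d.+1%:R) :> R.
    by rewrite addr0 factS natrM exprS !invfM; ring.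
  have : (fun i => 'C(x i + d, d)%:R / i%:R ^+ d *
      (((x i)%:R / i%:R + d.+1%:R / i%:R) / d.+1%:R) : R) @ \oo -->
      ((q%:R ^+ d)^-1 / d`!%:R * ((q%:R^-1 + 0) / d.+1%:R) : R) by exact: cvgM.
  apply: cvg_trans; apply: near_eq_cvg; near=> i.
  have i0 : i%:R != 0 :> R.
    by rewrite pnatr_eq0 -lt0n; near: i; exact: nbhs_infty_gt.
  have d0 : d.+1%:R != 0 :> R by rewrite pnatr_eq0.
  have /(congr1 (fun m => m%:R : R)) := mul_bin_diag (x i + d).+1 d.
  rewrite !natrM /= -addnS => E.
  have -> : 'C(x i + d.+1, d.+1)%:R = ((x i)%:R + d.+1%:R) * 'C(x i + d, d)%:R / d.+1%:R :> R.
    by rewrite -natrD E mulrAC divff ?mul1r.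
  rewrite exprS; move: (d.+1%:R : R) d0 => D d0.
  by field; rewrite i0 d0 expf_neq0.
move: key; apply: cvg_trans; apply: near_eq_cvg; near=> i.
by have -> : (a <= i)%N by [near: i; exact: nbhs_infty_ge]; rewrite mul1n.
Unshelve. all: by end_near. Qed.

Lemma powR_gt_nat (r M : R) : 0 < r -> \forall i \near \oo, M <= (i%:R : R) `^ r.
Proof.
move=> r0; near=> i.
have [M0|M0] := leP M 0; first exact: le_trans M0 (powR_ge0 _ _).
have iM : M `^ r^-1 <= i%:R :> R by near: i; exact: nbhs_infty_ger.
apply: le_trans (ge0_ler_powR (ltW r0) _ _ iM); rewrite ?nnegrE ?powR_ge0 ?ler0n //.
by rewrite -powRrM mulVf ?gt_eqF // powRr1 // ltW.
Unshelve. all: by end_near. Qed.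

(** Above, h(i) <= (c + 1) i^d <= i^(d + e) for large i. Below, an exponent r < d would bound (c/2)
    i^(d - r) by 1. *)
Lemma growth_asym h d c : 0 < c -> asym h d c -> growth R h = d%:R%:E.
Proof.
move=> c0 hc; apply/eqP; rewrite eq_le; apply/andP; split.
  apply/lee_addgt0Pr => e e0; apply: ereal_inf_lbound; exists (d%:R + e) => //.
  split; first by rewrite addr_ge0 // ltW.
  near=> i.
  have i0 : (0 : R) < i%:R by rewrite ltr0n; near: i; exact: nbhs_infty_gt.
  have hi : (h i)%:R / i%:R ^+ d <= c + 1.
    by apply/ltW; near: i; apply: (cvgr_lt _ hc); rewrite ltrDl.
  have ie : c + 1 <= i%:R `^ e by near: i; exact: powR_gt_nat.
  have -> : (i%:R : R) `^ (d%:R + e) = i%:R ^+ d * i%:R `^ e.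
    by rewrite powRD ?(gt_eqF i0) ?implybT // powR_mulrn // ltW.
  by rewrite mulrC -ler_pdivrMr ?exprn_gt0 // (le_trans hi).
apply: le_ereal_inf_tmp => _ [r [r0 hr] <-]; rewrite lee_fin leNgt; apply/negP => rd.
(* The constant 2/c + 1 is chosen because c/2 times it is 1 + c/2 > 1. *)
suff [i [i0 hi ci ie]] : exists i : nat, [/\ (0 : R) < i%:R, (h i)%:R <= (i%:R : R) `^ r,
    c / 2 <= (h i)%:R / i%:R ^+ d & 2 / c + 1 <= (i%:R : R) `^ (d%:R - r)].
  have : c / 2 * i%:R ^+ d <= i%:R `^ r.
    by apply: le_trans hi; rewrite -ler_pdivlMr ?exprn_gt0.
  have -> : (i%:R : R) ^+ d = i%:R `^ (d%:R - r) * i%:R `^ r.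
    by rewrite -powRD ?subrK ?powR_mulrn ?ltW // (gt_eqF i0) implybT.
  rewrite mulrA ger_pMl ?powR_gt0 // => {}ci.
  have : c / 2 * (2 / c + 1) <= 1.
    by apply: le_trans ci; rewrite ler_pM2l // divr_gt0.
  by rewrite mulrDr mulr1 mulrA divfK // divff ?gt_eqF // gerDl leNgt divr_gt0.
near \oo => i; exists i; split.
- by rewrite ltr0n; near: i; exact: nbhs_infty_gt.
- by near: i.
- apply/ltW; near: i; apply: (cvgr_gt _ hc).
  by rewrite ltr_pdivrMr // ltr_pMr // ltr1n.
- by near: i; apply: powR_gt_nat; rewrite subr_gt0.
Unshelve. all: by end_near. Qed.

Lemma growth0 : growth R (fun=> 0%N) = 0%E.
Proof.
apply/eqP; rewrite eq_le; apply/andP; split.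
  apply: ereal_inf_lbound; exists 0 => //; split => //.
  by near=> i; exact: powR_ge0.
by apply: le_ereal_inf_tmp => _ [r [r0 _] <-]; rewrite lee_fin.
Unshelve. all: by end_near. Qed.

(* The second case is that of the zero module. *)
Definition hdata h d c := [/\ asym h d c, 0 < c & (0 < d)%N] \/
  [/\ forall i, h i = 0%N, d = 0%N & c = 0].

Lemma hdata_asym h d c : hdata h d c -> asym h d c.
Proof. by case=> [[]//|[h0 -> ->]]; rewrite (funext h0 : h = fun=> 0%N); exact: asym0. Qed.

Lemma hdata_growth h d c : hdata h d c -> growth R h = d%:R%:E.
Proof.
case=> [[hc c0 _]|[h0 -> _]]; first exact: growth_asym hc.
by rewrite (funext h0 : h = fun=> 0%N) growth0.
Qed.

Lemma hdata_squeeze h h' d c a b : hdata h d c ->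
  (forall i, h' i <= h (i + a))%N -> (forall i, h i <= h' (i + b))%N -> hdata h' d c.
Proof.
move=> + ha hb; case=> [[hc c0 d0]|[h0 -> ->]]; [left|right]; split=> //.
  exact: asym_squeeze hc ha hb.
by move=> i; apply/eqP; rewrite -leqn0 -(h0 (i + a)%N).
Qed.

(** Leading coefficients of nonzero modules are positive, so nothing cancels; the boolean factors
    keep the terms of maximal degree. The trichotomy of the theorem is read off from this
    formula. *)
Lemma hdata_add h1 h2 d1 d2 c1 c2 : hdata h1 d1 c1 -> hdata h2 d2 c2 ->
  hdata (fun i => h1 i + h2 i)%N (maxn d1 d2)
    ((d2 <= d1)%N%:R * c1 + (d1 <= d2)%N%:R * c2).
Proof.
case=> [[h1c c10 d10]|[h10 -> ->]]; case=> [[h2c c20 d20]|[h20 -> ->]].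
- left; rewrite leq_max d10; case: (ltngtP d1 d2) => [d12|d21|d12].
  + rewrite mul0r mul1r; split; rewrite ?add0r ?orbT // -[c2]add0r.
    by apply: asym_add => //; exact: asym_lt h1c.
  + rewrite mul0r mul1r; split; rewrite ?addr0 // -[c1]addr0.
    by apply: asym_add => //; exact: asym_lt h2c.
  + rewrite !mul1r -d12; split=> //; last exact: addr_gt0.
    by apply: asym_add => //; rewrite d12.
- left; rewrite maxn0 leq0n mul1r mulr0 addr0; split=> //.
  by rewrite (_ : (fun i => _) = h1) //; apply/funext => i; rewrite h20 addn0.
- left; rewrite max0n leq0n mulr0 mul1r add0r; split=> //.
  by rewrite (_ : (fun i => _) = h2) //; apply/funext => i; rewrite h10.
- by right; split=> [i||]; rewrite ?h10 ?h20 ?maxnn // !mulr0 addr0.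
Qed.

Lemma hdata_binomial_sum q (s : seq (nat * nat)) : (0 < q)%N ->
  (forall x, x \in s -> (0 < x.2)%N) ->
  exists d c, hdata (fun i => \sum_(x <- s) (x.1 <= i) * 'C((i - x.1) %/ q + x.2, x.2))%N d c.
Proof.
move=> q0; elim: s => [|x s IH] s0.
  by exists 0%N, 0; right; split=> // i; rewrite big_nil.
have [|d [c hs]] := IH; first by move=> y ys; apply: s0; rewrite inE ys orbT.
have hx : hdata (fun i => (x.1 <= i) * 'C((i - x.1) %/ q + x.2, x.2))%N x.2
    ((q%:R ^+ x.2)^-1 / x.2`!%:R).
  left; split; [exact: asym_binomial| |exact: s0 (mem_head _ _)].
  by rewrite divr_gt0 ?invr_gt0 ?exprn_gt0 ?ltr0n ?fact_gt0.
have := hdata_add hx hs; set d' := maxn _ _; set c' := _ + _ => H.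
exists d', c'; rewrite (_ : (fun i => _) = (fun i => (x.1 <= i) * 'C((i - x.1) %/ q + x.2, x.2) +
  \sum_(x <- s) (x.1 <= i) * 'C((i - x.1) %/ q + x.2, x.2))%N) //.
by apply/funext => i; rewrite big_cons.
Qed.

Lemma asym_littleo h d c : asym h d c <->
  (fun i => (h i)%:R : R) = (fun i => c * i%:R ^+ d) +o_\oo (fun i : nat => i%:R ^+ d : R).
Proof.
have E i : (0 < i)%N -> forall e : R,
    (`|c - (h i)%:R / i%:R ^+ d| <= e) =
    (`|(h i)%:R - c * i%:R ^+ d| <= e * `|i%:R ^+ d|).
  move=> i0 e; have id0 : 0 < (i%:R : R) ^+ d by rewrite exprn_gt0 // ltr0n.
  have -> : c - (h i)%:R / i%:R ^+ d = - (((h i)%:R - c * i%:R ^+ d) / i%:R ^+ d).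
    by rewrite mulrBl mulfK ?gt_eqF // opprB.
  by rewrite normrN normf_div (gtr0_norm id0) ler_pdivrMr.
rewrite eqaddoP; split=> [/cvgrPdist_le hc e e0|ho].
  near=> i; rewrite -[X in is_true X]/(`|(h i)%:R - c * i%:R ^+ d| <= e * `|i%:R ^+ d|).
  rewrite -E; last by near: i; exact: nbhs_infty_gt.
  by near: i; exact: hc.
apply/cvgrPdist_le => e e0; near=> i; rewrite E; last by near: i; exact: nbhs_infty_gt.
by near: i; exact: ho.
Unshelve. all: by end_near. Qed.

End Asymptotics.

Lemma findim_mspan (K : fieldType) (B : algType K) (M : lmodType B) (A : set B)
  (S : set (kres M)) : findim A -> findim S -> findim (mspan A S).
Proof.
move=> /findim_kspanP[a ->] /findim_kspanP[s ->]; rewrite mspan_kspanl mspan_kspanr.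
apply/findim_kspanP; exists [seq act u m | u <- a, m <- s]; congr kspan.
apply/seteqP; split=> x; first by move=> [u ua [m ms <-]]; exact: allpairs_f.
by move=> /allpairsP[[u m] [ua ms ->]]; exists u => //; exists m.
Qed.

Lemma has_kdim_inj (K : fieldType) (V V' : lmodType K) (f : V -> V') (W : set V) d :
  linear f -> injective f -> has_kdim (f @` W) d -> has_kdim W d.
Proof.
move=> fl fi [s [sf sE]].
have /choice[t /all_and2[tW ts]] j : exists t, W t /\ f t = s j.
  have : (f @` W) (s j) by rewrite sE; apply: sub_kspan; exists j.
  by move=> [t ? ?]; exists t.
have fW : f @` W = f @` kspan (range t).
  rewrite sE image_kspan //; congr kspan; apply/seteqP; split.
    by move=> _ [j _ <-]; exists (t j); [exists j | exact: ts].
  by move=> _ [_ [j _ <-] <-]; exists j; rewrite ?ts.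
exists t; split.
  move=> c c0; apply: sf; transitivity (f 0); last exact: linmap0.
  rewrite -c0 (linmap_sum fl).
  by apply: eq_bigr => j _; rewrite (linmapZ fl) ts.
apply/seteqP; split=> x Wx.
  have : (f @` W) (f x) by exists x.
  by rewrite fW => -[y Wy /fi <-].
have : (f @` kspan (range t)) (f x) by exists x.
by rewrite -fW => -[y Wy /fi <-].
Qed.

(** * Filtrations of modules *)

Section Filtrations.
Variables (K : fieldType) (n : nat).
Local Notation D := (diffop (polyalg K n)).
Local Notation F i := (@canonical_filt K n i).

Lemma canonical_standard : standard_alg_filt (@canonical_filt K n).
Proof.
split; last first.
  by exists 1%N, 0%N, 1%N, 0%N; split=> //; near=> i; rewrite !mul1n !addn0; split.
split.
- split; [exact: findim_F | by move=> i; exact: F_leq |].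
  by apply/seteqP; split=> // u _; have [i Fu] := F_exhaust u; exists i.
- exact: F_one.
- by move=> i j u v; exact: F_mul.
Unshelve. all: by end_near. Qed.

Section Module.
Variable M : lmodType D.
Implicit Types (S : set (kres M)).

Lemma mspan_F_leq S i j : (i <= j)%N -> mspan (F i) S `<=` mspan (F j) S.
Proof. by move=> ij; apply: mspanS => //; exact: F_leq. Qed.

Lemma mspan_F_act S i j u m : F i u -> mspan (F j) S m -> mspan (F (i + j)%N) S (act u m).
Proof.
move=> Fu; move: m; suff : mspan (F j) S `<=` act u @^-1` mspan (F (i + j)%N) S by [].
apply: mspan_min.
  by apply: subspace_preimage; [exact: act_linear | exact: mspan_subspace].
by move=> v m Fv Sm; rewrite /preimage /= -actM; apply: mspan_act => //; exact: F_mul.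
Qed.

Lemma mspan_F_exhaust S m : mspan setT S m -> exists i, mspan (F i) S m.
Proof.
move: m; suff : mspan setT S `<=` [set m | exists i, mspan (F i) S m] by [].
apply: mspan_min; last first.
  by move=> u m _ Sm; have [i Fu] := F_exhaust u; exists i; exact: mspan_act.
split; first by exists 0%N; case: (mspan_subspace (F 0%N) S).
move=> c u v [i iu] [j jv]; exists (maxn i j).
by apply mspan_subspace; [apply: mspan_F_leq iu | apply: mspan_F_leq jv];
  rewrite ?leq_maxl ?leq_maxr.
Qed.

Lemma mspan_F_findim S i : findim S -> findim (mspan (F i) S).
Proof. by move=> Sf; apply: findim_mspan => //; exact: findim_F. Qed.

(** Finitely many vectors lie in a common step F_a of the filtration generated by [S'], and F_i F_a
    is contained in F_(i + a). *)
Lemma mspan_F_shift S S' : findim S -> S `<=` mspan setT S' ->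
  exists a, forall i, mspan (F i) S `<=` mspan (F (i + a)%N) S'.
Proof.
move=> /findim_kspanP[s ->] sS'.
have {sS'} : forall x, x \in s -> exists a, mspan (F a) S' x.
  by move=> x xs; apply/mspan_F_exhaust/sS'; exact: sub_kspan.
move=> sa; have [a aP] : exists a, forall x, x \in s -> mspan (F a) S' x.
  elim: s sa => [|x s IH] sa; first by exists 0%N.
  have [|a aP] := IH; first by move=> y ys; apply: sa; rewrite inE ys orbT.
  have [b bP] := sa x (mem_head _ _); exists (maxn a b) => y; rewrite inE.
  move=> /orP[/eqP->|/aP].
    by apply: mspan_F_leq bP; exact: leq_maxr.
  by apply: mspan_F_leq; exact: leq_maxl.
exists a => i; rewrite mspan_kspanr; apply: mspan_min; first exact: mspan_subspace.
by move=> u x Fu /aP; exact: mspan_F_act.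
Qed.

Lemma hilb_shift S S' : generating S -> generating S' ->
  exists a, forall i, (hilb S i <= hilb S' (i + a))%N.
Proof.
move=> [Sf _] [S'f S'g]; have [|a aP] := @mspan_F_shift S S' Sf; first by rewrite S'g.
by exists a => i; apply: kdimS; [exact: mspan_F_findim | exact: mspan_F_findim | exact: aP].
Qed.

Lemma fd_mod_filtration_mspan S : generating S ->
  fd_mod_filtration (fun i => mspan (F i) S).
Proof.
move=> [Sf Sg]; split.
  split=> [i|i|]; [exact: mspan_F_findim|exact: mspan_F_leq|].
  apply/seteqP; split=> // m _; have [|i im] := @mspan_F_exhaust S m; first by rewrite Sg.
  by exists i.
exists (@canonical_filt K n); split; first exact: canonical_standard.
by move=> i j u m Fu Sm; exact: mspan_F_act.
Qed.

Lemma standard_mod_filt_mspan S : generating S ->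
  standard_mod_filt (fun i => mspan (F i) S).
Proof.
by move=> Sg; exists (@canonical_filt K n), S; split=> //; exact: canonical_standard.
Qed.

Variable R : realType.

Lemma Dim_mult_hdata S d (c : R) : hdata (hilb S) d c ->
  Dim R S = d%:R%:E /\ mult R S = c * d`!%:R.
Proof.
move=> hd; have DS : Dim R S = d%:R%:E by exact: hdata_growth hd.
split=> //; have d0 : d`!%:R != 0 :> R by rewrite pnatr_eq0 -lt0n fact_gt0.
rewrite /mult; case: xgetP => [e _ [d' [Dd' /asym_littleo he]]|/(_ (c * d`!%:R))].
  have dd' : d' = d.
    by move: Dd'; rewrite DS => /(congr1 fine) /= /eqP; rewrite eqr_nat => /eqP.
  (* Dim fixes the exponent, and uniqueness of limits then forces e / d! = c. *)
  rewrite dd' in he; apply/eqP; rewrite -[e](divfK d0) (inj_eq (mulIf d0)); apply/eqP.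
  exact: (cvg_unique _ he (hdata_asym hd)).
case; exists d; split=> //; apply/asym_littleo; rewrite mulfK //.
exact: hdata_asym.
Qed.

Lemma hdata_generating p S : p \in [pchar K] -> (0 < n)%N -> finitely_presented M ->
  generating S -> exists d (c : R), hdata (hilb S) d c.
Proof.
move=> pK n0 Mfp [[r [s [_ SE]]] _].
have [k kP] := fp_ddiv_free pK Mfp s.
have qP := pascal_step_pchar k pK.
have q0 : (0 < p ^ k)%N by rewrite expn_gt0 prime_gt0 // (pcharf_prime pK).
have [L [L0 LE]] := hilbert_function q0 qP n0 (kP k (leqnn k)).
have [d [c hd]] := hdata_binomial_sum R q0 L0.
exists d, c; rewrite (_ : hilb S = fun i => \sum_(x <- L) (x.1 <= i) *
  'C((i - x.1) %/ p ^ k + x.2, x.2))%N //.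
by apply/funext => i; rewrite /hilb SE mspan_kspanr (kdimE (LE i)).
Qed.

End Module.

Lemma fp_generating (M : lmodType D) : finitely_presented M ->
  exists r (s : 'I_r -> kres M), generating (kspan (range s)).
Proof.
move=> [a [b [P [Q [Psurj _]]]]]; exists a, (fun j => P (delta_mx 0 j)); split.
  apply/findim_kspanP; exists [seq P (delta_mx 0 j) : kres M | j <- enum 'I_a].
  congr kspan; apply/seteqP; split=> x.
    by move=> [j _ <-]; apply: map_f; rewrite mem_enum.
  by move=> /mapP[j _ ->]; exists j.
apply/seteqP; split=> // m _; have : range P m by rewrite Psurj.
move=> [e _ <-]; rewrite {1}(row_sum_delta e) linear_sum mspan_kspanr.
apply: (@subspace_sum _ _ (mspan setT (range (fun j => P (delta_mx 0 j) : kres M)))) => [|j _].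
  exact: mspan_subspace.
rewrite linearZ; apply: (@mspan_act _ _ _ _ _ (e 0 j) (P (delta_mx 0 j))) => //.
Qed.

End Filtrations.

(** * Filtrations along a short exact sequence *)

Section ShortExact.
Variables (K : fieldType) (n p : nat) (pK : p \in [pchar K]) (n0 : (0 < n)%N).
Local Notation D := (diffop (polyalg K n)).
Local Notation F i := (@canonical_filt K n i).
Variables (N M L : lmodType D) (f : {linear N -> M}) (g : {linear M -> L}).
Hypotheses (fpL : finitely_presented L) (fg : short_exact f g).

Let f_inj : injective (kmap f). Proof. by case: fg. Qed.
Let kmap_fg m : kmap g m = 0 <-> exists x, kmap f x = m.
Proof.
have [_ fgE _] := fg; split=> [gm|[x <-]].
  have : (range f) m by rewrite fgE.
  by move=> [x _ xm]; exists x.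
by have : (g @^-1` [set 0%R]) (f x) by rewrite -fgE; exists x.
Qed.
Let g_surj y : exists m, kmap g m = y.
Proof.
have [_ _ gE] := fg; have : range g y by rewrite gE.
by move=> [m _ my]; exists m.
Qed.

Variable M0 : set (kres M).
Hypothesis M0g : generating M0.

(** The filtration induced by M: with it dimensions are additive at every i, at the price of not
    being visibly of the form F_i N_0. *)
Definition sub_filt i : set (kres N) := kmap f @^-1` mspan (F i) M0.

Lemma generating_image : generating (kmap g @` M0).
Proof.
have [M0f M0E] := M0g; split; first exact: (findim_image (kmap_linear g) M0f).
rewrite -kmap_mspan M0E; apply/seteqP; split=> // y _.
by have [m <-] := g_surj y; exists m.
Qed.

(** The Artin-Rees property, applied to the images in L of a basis of M_0, gives the first inclusion
    with no shift; finite presentation of L makes that image family free over the d^[q g]. *)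
Lemma kernel_generating : exists2 N0, generating N0 &
  exists b, forall i, sub_filt i `<=` mspan (F i) N0 /\ mspan (F i) N0 `<=` sub_filt (i + b)%N.
Proof.
have [[r [s [_ SE]]] M0E] := M0g.
have [k kP] := fp_ddiv_free pK fpL (kmap g \o s).
have qP := pascal_step_pchar k pK.
have q0 : (0 < p ^ k)%N by rewrite expn_gt0 prime_gt0 // (pcharf_prime pK).
have [S [Sker SP]] := kernel_filtration q0 qP (kP k (leqnn k)).
have /choice[l lP] m : exists x, m \in S -> kmap f x = m.
  case: (boolP (m \in S)) => [/Sker/kmap_fg[x <-]|_]; [by exists x | by exists 0].
pose N0 : set (kres N) := kspan [set` map l S].
have N0f : findim N0 by exact: findim_seq.
have fN0 i : kmap f @` mspan (F i) N0 = mspan (F i) [set` S].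
  rewrite kmap_mspan /N0 image_kspan; last exact: kmap_linear.
  rewrite mspan_kspanr; congr (mspan _ _); apply/seteqP; split=> [_ [_ /mapP[m mS ->] <-]|m mS].
    by rewrite lP.
  by exists (l m); [exact: map_f | exact: lP].
have subN0 i : sub_filt i `<=` mspan (F i) N0.
  move=> x xi; have : mspan (F i) [set` S] (kmap f x).
    apply: SP; last by apply/kmap_fg; exists x.
    by move: xi; rewrite /sub_filt /preimage /= SE mspan_kspanr.
  by rewrite -fN0 => -[y ys /f_inj <-].
exists N0.
  split=> //; apply/seteqP; split=> // x _.
  have [|i im] := @mspan_F_exhaust _ _ _ M0 (kmap f x); first by rewrite M0E.
  by apply: (mspanS _ (fun _ => id) (subN0 i x im)).
(* b is a step of the filtration of M that contains the kernel generators. *)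
have [|b bP] := @mspan_F_shift _ _ _ (kspan [set` S]) M0 (findim_seq _); first by rewrite M0E.
exists b => i; split=> // x xi; apply: bP; rewrite mspan_kspanr -fN0.
by exists x.
Qed.

Lemma sub_filt_kdim i : findim (sub_filt i) /\
  kdim (mspan (F i) M0) = (kdim (sub_filt i) + kdim (mspan (F i) (kmap g @` M0)))%N.
Proof.
have [M0f _] := M0g.
have [kf kE] := rank_nullity (kmap_linear g) (mspan_F_findim (S := M0) i M0f).
have fE : kmap f @` sub_filt i = mspan (F i) M0 `&` kmap g @^-1` [set 0%R].
  apply/seteqP; split=> [_ [x xi <-]|m [mi /kmap_fg[x xm]]].
    by split=> //; apply/kmap_fg; exists x.
  by exists x => //; rewrite /sub_filt /preimage /= xm.
have := findimP kf; rewrite -fE => /(has_kdim_inj (kmap_linear f) f_inj) Nd.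
split; first by exists (kdim (kmap f @` sub_filt i)).
by rewrite kE kmap_mspan -fE (kdimE Nd).
Qed.

Lemma sub_filt_filtration : fd_mod_filtration sub_filt.
Proof.
have [M0f M0E] := M0g; split.
  split=> [i|i x|]; first by have [] := sub_filt_kdim i.
    by apply: mspan_F_leq.
  apply/seteqP; split=> // x _.
  have [|i im] := @mspan_F_exhaust _ _ _ M0 (kmap f x); first by rewrite M0E.
  by exists i.
exists (@canonical_filt K n); split; first exact: canonical_standard.
move=> i j u x Fu xj; rewrite /sub_filt /preimage /= -/(act u (x : kres N)) kmap_act.
exact: mspan_F_act.
Qed.

End ShortExact.

Theorem theorem5p10 (R : realType) (K : fieldType) (p : nat)
    (charK : p \in [pchar K]) (n : nat) (n_gt0 : (0 < n)%N)
    (N M L : lmodType (diffop (polyalg K n)))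
    (fpN : finitely_presented N) (fpM : finitely_presented M)
    (fpL : finitely_presented L)
    (f : {linear N -> M}) (g : {linear M -> L}) (exact_fg : short_exact f g) :
  (exists (N_ : nat -> set (kres N)) (M_ : nat -> set (kres M))
      (L_ : nat -> set (kres L)),
    [/\ fd_mod_filtration N_, fd_mod_filtration M_ & fd_mod_filtration L_] /\
    [/\ standard_mod_filt M_, standard_mod_filt L_,
        exists N'_, standard_mod_filt N'_ /\ strong_equiv_filt N_ N'_ &
        forall i, kdim (M_ i) = (kdim (N_ i) + kdim (L_ i))%N]) /\
  (forall (N0 : set (kres N)) (M0 : set (kres M)) (L0 : set (kres L)),
    generating N0 -> generating M0 -> generating L0 ->
    Dim R M0 = maxe (Dim R N0) (Dim R L0) /\
    exactly_one
      [/\ (Dim R N0 < Dim R M0)%E, Dim R M0 = Dim R L0 &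
          mult R M0 = mult R L0]
      [/\ (Dim R L0 < Dim R M0)%E, Dim R M0 = Dim R N0 &
          mult R M0 = mult R N0]
      [/\ Dim R N0 = Dim R M0, Dim R M0 = Dim R L0 &
          mult R M0 = mult R N0 + mult R L0]).
Proof.
have [r [s M1g]] := fp_generating fpM; set M1 := kspan _ in M1g.
have L1g := generating_image exact_fg M1g.
have [N1 N1g [b N1P]] := kernel_generating charK fpL exact_fg M1g.
split.
  exists (sub_filt f M1), (fun i => mspan (@canonical_filt K n i) M1),
    (fun i => mspan (@canonical_filt K n i) (kmap g @` M1)); split.
    split; first exact: (sub_filt_filtration exact_fg M1g).
      exact: fd_mod_filtration_mspan.
    exact: fd_mod_filtration_mspan.
  split.
  - exact: standard_mod_filt_mspan.
  - exact: standard_mod_filt_mspan.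
  - exists (fun i => mspan (@canonical_filt K n i) N1); split.
      exact: standard_mod_filt_mspan.
    by exists 0%N, b; near=> i; rewrite addn0.
  - by move=> i; have [] := sub_filt_kdim exact_fg M1g i.
move=> N0 M0 L0 N0g M0g L0g.
have [dN [cN hN]] := hdata_generating R charK n_gt0 fpN N0g.
have [dL [cL hL]] := hdata_generating R charK n_gt0 fpL L0g.
(* The given [N0], [M0], [L0] are unrelated to each other; their growth data are transported to the
   compatible filtrations built from [M1], where additivity holds. *)
have hL1 : hdata (hilb (kmap g @` M1)) dL cL.
  have [a aP] := hilb_shift L1g L0g; have [a' aP'] := hilb_shift L0g L1g.
  exact: hdata_squeeze hL aP aP'.
have hN1 : hdata (fun i => kdim (sub_filt f M1 i)) dN cN.
  have [a aP] := hilb_shift N1g N0g; have [a' aP'] := hilb_shift N0g N1g.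
  have sf i : findim (sub_filt f M1 i) by have [] := sub_filt_kdim exact_fg M1g i.
  have N1f i : findim (mspan (@canonical_filt K n i) N1).
    by apply: mspan_F_findim; case: N1g.
  (* Passing from [N0] to [N1] costs a', and from [N1] to the induced filtration costs b. *)
  apply: (hdata_squeeze (a := a) (b := (a' + b)%N) hN) => i.
    by apply: leq_trans (aP i); apply: kdimS => //; have [] := N1P i.
  by apply: leq_trans (aP' i) _; rewrite addnA; apply: kdimS => //; have [] := N1P (i + a')%N.
have hM : hdata (hilb M0) (maxn dN dL) ((dL <= dN)%N%:R * cN + (dN <= dL)%N%:R * cL).
  have [a aP] := hilb_shift M0g M1g; have [a' aP'] := hilb_shift M1g M0g.
  apply: hdata_squeeze aP aP'; have := hdata_add hN1 hL1; congr hdata.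
  by apply/funext => i; rewrite /hilb; have [_ ->] := sub_filt_kdim exact_fg M1g i.
have [DN mN] := Dim_mult_hdata hN; have [DL mL] := Dim_mult_hdata hL.
have [DM mM] := Dim_mult_hdata hM.
have lt_irr (x : \bar R) : ~ (x < x)%E by rewrite ltxx.
rewrite /exactly_one DN DL DM mN mL mM -EFin_max -natr_max; split=> //.
have natE (x y : nat) : x%:R%:E = y%:R%:E :> \bar R -> x = y.
  by move=> /(congr1 fine) /= /eqP; rewrite eqr_nat => /eqP.
(* The comparison of dN with dL selects the alternative, and each of the other two contradicts
   it. *)
rewrite !lte_fin !ltr_nat; case: (ltngtP dN dL) => [lt|lt|eq].
- apply: Or31; split; first by split=> //; rewrite mul0r mul1r add0r.
    by move=> [_ /natE E]; rewrite E ltnn in lt.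
  by move=> [/natE E]; rewrite E ltnn in lt.
- apply: Or32; split.
  + by move=> [_ /natE E]; rewrite E ltnn in lt.
  + by split=> //; rewrite mul0r mul1r addr0.
  + by move=> [_ /natE E]; rewrite E ltnn in lt.
- apply: Or33; split.
  + by case; rewrite eq ltnn.
  + by case; rewrite eq ltnn.
  + by rewrite eq !mul1r mulrDl.
Unshelve. all: by end_near. Qed.
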